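(* Let $g \geq 2$ be a fixed integer. Suppose $(k, \lambda)$ runs through a sequence of ordered pairs of positive integers such that $k \geq 3$, $\lambda \to \infty$, and, if $g$ is even, each $\lambda$ is also even. Suppose also that there exists some $\varepsilon_0 > 0$ so that $k < \left(\frac{1}{6} - \varepsilon_0\right) \frac{\log(\lambda g)}{\log(g)}$ for all pairs in the sequence. Then along the sequence $(k, \lambda)$ the number of $(g, k; \lambda)$-difference matrices over $\mathbb Z_g$ is \[ \frac{ g^{k \lambda g + \frac{(3k-4)(k-1)}{4}}}{\sqrt{(2 \pi \lambda)^{\binom{k}{2}(g-1)}}}[1 + o(1)].\]
   Context: Let $\mathbb Z_g$ denote the cyclic group of integers modulo $g$. A $(g, k; \lambda)$-difference matrix over $\mathbb Z_g$ is a $k \times g\lambda$ matrix $D = [d_{i\ell}]$ with entries in $\mathbb Z_g$ such that for each pair of rows $1 \leq i < j \leq k$, the multiset $\{d_{i\ell} - d_{j\ell} : 1 \leq \ell \leq g\lambda\}$ contains every element of $\mathbb Z_g$ exactly $\lambda$ times. Matrices are counted as arrays (no identification up to equivalence). *)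

(* Defs.v *)
From HB Require Import structures.
From mathcomp Require Import all_boot all_order all_algebra.

Set Implicit Arguments.
Unset Strict Implicit.
Unset Printing Implicit Defensive.

Import GRing.Theory.
Local Open Scope ring_scope.

(* A (g,k;lam)-difference matrix over Z_g: a k x (g*lam) matrix such that for
   every pair of rows i < j, each x in Z_g occurs exactly lam times in the
   multiset of differences D i l - D j l.  ('Z_g is Z/gZ only for g >= 2,
   which the theorem assumes.) *)
Definition is_diff_matrix (g k lam : nat) (D : 'M['Z_g]_(k, g * lam)) : bool :=
  [forall i : 'I_k, forall j : 'I_k, (i < j)%N ==>
     [forall x : 'Z_g,
        #|[pred l : 'I_(g * lam) | D i l - D j l == x]| == lam]].

Definition num_diff_matrices (g k lam : nat) : nat :=
  #|[pred D : 'M['Z_g]_(k, g * lam) | is_diff_matrix D]|.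

Definition choose (n m : nat) : nat := 'C(n, m).

(* Main.v *)
(* The columns of a difference matrix are the steps of a walk recording, for
   every pair of rows p, the difference pi_p(v) = v_i - v_j of a uniform random
   v in Z_g^k.  A finite Fourier transform writes the number of balanced walks
   of N = g lam steps as a sum over frequencies u : pairs x Z_g -> circle.
   A mixed second difference in v_i and v_j isolates the factor u_p, so a mean
   close to the unit circle forces every u_p to be close to c_p chi(a_p x) for
   some a with sum_p a_p pi_p = 0.  The terms are invariant under twisting by
   such an a, so the main part is the number h = g^(C(k,2)-k+1) of these a
   times the sum over frequencies near the trivial one.  There the summand is
   (1 - s/2)^N up to a factor close to 1, where s only involves the covariance
   of the steps.  As the differences pi_p are pairwise independent, s is the
   same as for the model with mutually independent pi_p, where the count is the
   power (N! / lam!^g)^C(k,2) of a multinomial coefficient.  Thus no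
   multidimensional Gaussian integral is ever evaluated: the count is h times
   that of the model, up to normalisation, and Stirling's formula finishes. *)
Require Import Defs.
From Stdlib Require Import Reals.
From Stdlib Require Import Factorial Lra Lia.
Open Scope R_scope.

(** * Trigonometric bounds *)

(** The window around the trivial frequency must meet two opposite demands. Write N = g lam, L = ln
    N, n = C(k,2); the bound on k gives n <= L^2. Within distance d of the trivial frequency, the
    cubic Taylor error of the mean of a step, raised to the power N, costs about N (n d)^3. Outside
    the windows a term is at most exp(-c N d^2) with c of order g^(-3), and this must be negligible
    against the model's probability p^n >= exp(-g L^2 (L + 4)). With d = L^2 N^(-1/2) the first cost
    is a constant times L^12 N^(-1/2) and the second bound is exp(-c L^4), so both succeed for large
    lam. Frequencies take values in roots of unity of a fixed order, so that Fourier inversion is an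
    exact finite sum. Twisting preserves a term only if lam times the sum of all x in Z_g vanishes;
    that sum is g(g-1)/2 modulo g, which is the origin of the parity condition. *)

Lemma sin_cubic_lb (t : R) : 0 <= t <= PI -> t - t * t * t / 6 <= sin t <= t.
Proof.
intros [h0 h1]; split.
- destruct (sin_bound t 0 h0 h1) as [h _].
  unfold sin_approx, sin_term in h; simpl in h.
  replace (t - t * t * t / 6) with (-1 * 1 * (t * (t * (t * 1)) / (1+1+1+1+1+1)) + 1 * (t*1/1)) by field.
  lra.
- destruct (Req_dec t 0) as [->|hn]; [rewrite sin_0; lra|].
  left; apply sin_lt_x; lra.
Qed.

Lemma sin_abs_le (t : R) : Rabs (sin t) <= Rabs t.
Proof.
destruct (Rle_dec (Rabs t) PI) as [h|h].
- assert (H : forall u, 0 <= u <= PI -> Rabs (sin u) <= Rabs u).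
  { intros u hu. rewrite !Rabs_right; [apply sin_cubic_lb; lra|lra|].
    apply Rle_ge, sin_ge_0; lra. }
  destruct (Rle_dec 0 t) as [h0|h0].
  + apply H. rewrite Rabs_right in h by lra. lra.
  + rewrite <- (Rabs_Ropp t), <- Rabs_Ropp, <- sin_neg. apply H.
    rewrite Rabs_left in h by lra. lra.
- pose proof (SIN_bound t); pose proof PI2_1.
  apply Rle_trans with 1; [apply Rabs_le; lra|lra].
Qed.

Lemma sin_cubic (t : R) : Rabs t <= 1 -> Rabs (sin t - t) <= Rabs t ^ 3 / 2.
Proof.
intros h.
pose proof PI2_1 as hpi.
assert (H : forall u, 0 <= u <= 1 -> Rabs (sin u - u) <= u ^ 3 / 2).
{ intros u hu. assert (h3 : 0 <= u ^ 3) by (apply pow_le; lra).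
  destruct (sin_cubic_lb u) as [h1 h2]; [lra|].
  replace (u * u * u) with (u ^ 3) in h1 by ring.
  apply Rabs_le; lra. }
destruct (Rle_dec 0 t) as [h0|h0].
- rewrite (Rabs_right t) in * by lra. apply H; lra.
- rewrite (Rabs_left t) in * by lra.
  replace (sin t - t) with (- (sin (- t) - - t)) by (rewrite sin_neg; ring).
  rewrite Rabs_Ropp. apply H; lra.
Qed.

Lemma cos_half (t : R) : cos t = 1 - 2 * sin (t / 2) * sin (t / 2).
Proof. rewrite <- cos_2a_sin. f_equal; field. Qed.

(** By the half-angle formula the difference factors as -2 (sin(t/2) - t/2)(sin(t/2) + t/2), so the
    cubic error of the sine carries over. *)
Lemma cos_cubic (t : R) : Rabs t <= 1 -> Rabs (cos t - (1 - t ^ 2 / 2)) <= Rabs t ^ 3 / 2.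
Proof.
intros h.
replace (cos t - (1 - t ^ 2 / 2)) with (- (2 * (sin (t/2) - t/2) * (sin (t/2) + t/2)))
  by (rewrite (cos_half t); field).
rewrite Rabs_Ropp, !Rabs_mult, (Rabs_right 2) by lra.
assert (e : Rabs (t / 2) = Rabs t / 2).
{ unfold Rdiv; rewrite Rabs_mult, (Rabs_right (/ 2)); lra. }
assert (h1 : Rabs (sin (t/2) - t/2) <= (Rabs t / 2) ^ 3 / 2).
{ rewrite <- e; apply sin_cubic; rewrite e; pose proof (Rabs_pos t); lra. }
assert (h2 : Rabs (sin (t/2) + t/2) <= Rabs t).
{ eapply Rle_trans; [apply Rabs_triang|]. pose proof (sin_abs_le (t/2)); lra. }
pose proof (Rabs_pos t) as h0.
assert (h3 : 0 <= Rabs t ^ 3) by (apply pow_le; lra).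
replace ((Rabs t / 2) ^ 3 / 2) with (Rabs t ^ 3 / 16) in h1 by field.
apply Rle_trans with (2 * (Rabs t ^ 3 / 16) * 1); [|lra].
apply Rmult_le_compat; try lra; try apply Rabs_pos.
apply Rmult_le_pos; [lra|apply Rabs_pos].
Qed.

Lemma one_sub_cos_le (t : R) : 1 - cos t <= t ^ 2 / 2.
Proof.
rewrite cos_half. pose proof (sin_abs_le (t/2)) as h.
apply Rsqr_le_abs_1 in h. unfold Rsqr in h. nra.
Qed.

(** The half-angle formula reduces this to u <= PI sin u on [0, PI/2], for which the cubic bound and
    2 < PI <= 4 suffice; the constant is not optimal. *)
Lemma one_sub_cos_ge (t : R) : - PI <= t <= PI -> t ^ 2 <= 2 * PI ^ 2 * (1 - cos t).
Proof.
intros ht. pose proof PI2_1 as p1. pose proof PI_4 as p2.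
assert (H : forall u, 0 <= u <= PI / 2 -> u <= PI * sin u).
{ intros u hu. destruct (sin_cubic_lb u) as [h1 _]; [lra|].
  assert (hu2 : u * u <= 4) by nra.
  assert (u * (1/3) <= sin u) by nra.
  nra. }
assert (K : forall u, 0 <= u <= PI / 2 -> u ^ 2 <= PI ^ 2 * (sin u * sin u)).
{ intros u hu. specialize (H u hu).
  replace (PI ^ 2 * (sin u * sin u)) with ((PI * sin u) ^ 2) by ring.
  apply pow_incr; lra. }
rewrite cos_half.
destruct (Rle_dec 0 t) as [h0|h0].
- assert (h := K (t/2)). assert (h' := h ltac:(lra)). nra.
- assert (h := K (-t/2)). assert (h' := h ltac:(lra)).
  replace (- t / 2) with (- (t / 2)) in h' by field. rewrite sin_neg in h'. nra.
Qed.

Lemma polar (c s : R) : c ^ 2 + s ^ 2 = 1 -> exists t, (- PI <= t <= PI) /\ cos t = c /\ sin t = s.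
Proof.
intros h.
assert (hc : -1 <= c <= 1) by nra.
pose proof (acos_bound c) as hb.
assert (hs : sqrt (1 - c²) = Rabs s).
{ replace (1 - c²) with (s²) by (unfold Rsqr; nra). apply sqrt_Rsqr_abs. }
destruct (Rle_dec 0 s) as [h0|h0].
- exists (acos c). rewrite cos_acos, sin_acos, hs by lra. rewrite Rabs_right by lra. lra.
- exists (- acos c). rewrite cos_neg, sin_neg, cos_acos, sin_acos, hs by lra.
  rewrite Rabs_left by lra. lra.
Qed.

(** * Stirling's formula with an explicit error *)

Module Stirling.
From Coquelicot Require Import Coquelicot.

(** * Wallis integrals *)

Definition wallis (n : nat) : R := RInt (fun x => sin x ^ n) 0 (PI / 2).

Lemma ex_RInt_sin_pow (n : nat) : ex_RInt (fun x => sin x ^ n) 0 (PI / 2).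
Proof.
apply (ex_RInt_continuous (V := R_CompleteNormedModule)); intros z _.
apply (ex_derive_continuous (fun x => sin x ^ n)); auto_derive; exact I.
Qed.

Lemma wallis_0 : wallis 0 = PI / 2.
Proof.
unfold wallis; rewrite (RInt_ext _ (fun _ => 1)) by (intros; reflexivity).
rewrite RInt_const; unfold scal; simpl; unfold mult; simpl; lra.
Qed.

Lemma wallis_1 : wallis 1 = 1.
Proof.
unfold wallis.
assert (h : is_RInt (fun x => sin x ^ 1) 0 (PI / 2) (minus (- cos (PI / 2)) (- cos 0))).
{ apply (is_RInt_derive (fun x => - cos x)).
  - intros x _; auto_derive; [exact I|ring].
  - intros x _; apply (ex_derive_continuous (fun x => sin x ^ 1)); auto_derive; exact I. }
rewrite (is_RInt_unique _ _ _ _ h), cos_PI2, cos_0; unfold minus, plus, opp; simpl; ring.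
Qed.

(** Integration by parts: the difference of the integrands is the derivative of
    [- cos x * sin x ^ S n], which vanishes at both ends of the interval. *)
Lemma wallis_step (n : nat) : (INR n + 2) * wallis (S (S n)) = (INR n + 1) * wallis n.
Proof.
pose (f := fun x => (INR n + 2) * sin x ^ S (S n) - (INR n + 1) * sin x ^ n).
assert (h : is_RInt f 0 (PI / 2)
  (minus (- cos (PI / 2) * sin (PI / 2) ^ S n) (- cos 0 * sin 0 ^ S n))).
{ apply (is_RInt_derive (fun x => - cos x * sin x ^ S n)).
  - intros x _; unfold f; auto_derive; [exact I|].
    change (match n with 0%nat => 1 | S _ => INR n + 1 end) with (INR (S n)).
    rewrite S_INR; pose proof (sin2_cos2 x) as e; unfold Rsqr in e; simpl.
    replace (- (1 * - sin x) * (sin x * sin x ^ n) + - cos x * (1 * cos x * ((INR n + 1) * sin x ^ n)))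
      with (sin x * sin x * sin x ^ n - cos x * cos x * ((INR n + 1) * sin x ^ n)) by ring.
    replace (cos x * cos x) with (1 - sin x * sin x) by lra. ring.
  - intros x _; apply (ex_derive_continuous f); unfold f; auto_derive; repeat split; exact I. }
assert (h2 : is_RInt f 0 (PI / 2) (minus (scal (INR n + 2) (wallis (S (S n)))) (scal (INR n + 1) (wallis n)))).
{ apply (is_RInt_minus (V := R_NormedModule) (fun x => scal (INR n + 2) (sin x ^ S (S n))) (fun x => scal (INR n + 1) (sin x ^ n)));
  [apply (is_RInt_scal (V := R_NormedModule) (fun x => sin x ^ S (S n)))
  |apply (is_RInt_scal (V := R_NormedModule) (fun x => sin x ^ n))];
  apply (RInt_correct (V := R_CompleteNormedModule)), ex_RInt_sin_pow. }
pose proof (is_RInt_unique f _ _ _ h) as e; rewrite (is_RInt_unique f _ _ _ h2) in e.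
clear h h2; rename e into h2.
rewrite cos_PI2, sin_0 in h2; unfold minus, plus, opp, scal in h2; simpl in h2.
unfold mult in h2; simpl in h2; simpl. lra.
Qed.

Lemma wallis_decr (n : nat) : wallis (S n) <= wallis n.
Proof.
pose proof PI_RGT_0.
apply RInt_le; try apply ex_RInt_sin_pow; [lra|].
intros x hx; simpl.
assert (0 <= sin x) by (apply sin_ge_0; lra). pose proof (SIN_bound x).
assert (0 <= sin x ^ n) by (apply pow_le; lra). nra.
Qed.

Lemma wallis_pos (n : nat) : 0 < wallis n /\ 0 < wallis (S n).
Proof.
pose proof PI_RGT_0. induction n as [|n [h1 h2]].
- rewrite wallis_0, wallis_1; lra.
- split; [exact h2|]. pose proof (wallis_step n); pose proof (pos_INR n). nra.
Qed.

Lemma wallis_prod (n : nat) : (INR n + 1) * wallis n * wallis (S n) = PI / 2.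
Proof.
induction n as [|n IH].
- rewrite wallis_0, wallis_1; simpl; lra.
- rewrite S_INR. pose proof (wallis_step n) as h.
  replace ((INR n + 1 + 1) * wallis (S n) * wallis (S (S n)))
    with (((INR n + 2) * wallis (S (S n))) * wallis (S n)) by ring.
  rewrite h; lra.
Qed.

Lemma wallis_even (n : nat) :
  wallis (2 * n) * (4 ^ n * INR (fact n) ^ 2) = PI / 2 * INR (fact (2 * n)).
Proof.
induction n as [|n IH]; [simpl; rewrite wallis_0; lra|].
replace (2 * S n)%nat with (S (S (2 * n))) by lia.
pose proof (wallis_step (2 * n)) as h.
rewrite mult_INR in h; simpl (INR 2) in h.
rewrite !fact_simpl, !mult_INR, !S_INR, mult_INR; simpl (INR 2).
rewrite <- tech_pow_Rmult.
pose proof (pos_INR n).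
replace (wallis (S (S (2 * n))) * (4 * 4 ^ n * ((INR n + 1) * INR (fact n)) ^ 2)) with
  (((1 + 1) * INR n + 2) * wallis (S (S (2 * n))) * (4 ^ n * INR (fact n) ^ 2) * (2 * (INR n + 1))) by ring.
rewrite h.
replace (((1 + 1) * INR n + 1) * wallis (2 * n) * (4 ^ n * INR (fact n) ^ 2) * (2 * (INR n + 1))) with
  (((1 + 1) * INR n + 1) * (wallis (2 * n) * (4 ^ n * INR (fact n) ^ 2)) * (2 * (INR n + 1))) by ring.
rewrite IH; ring.
Qed.

(** By monotonicity [wallis (2 * n) ^ 2] lies between the products of [wallis (2 * n)] with its two
    odd neighbours, and [wallis_prod] evaluates both products. *)
Lemma wallis_bounds (n : nat) : (1 <= n)%nat ->
  2 * INR n / (2 * INR n + 1) * (PI / 4) <= INR n * wallis (2 * n) ^ 2 <= PI / 4.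
Proof.
intros hn. assert (h0 : 1 <= INR n) by (apply (le_INR 1); lia).
destruct n as [|n]; [lia|]. clear hn.
set (w := wallis (2 * S n)).
pose proof (wallis_pos (2 * S n)) as [p1 p2].
assert (e1 : (2 * INR (S n) + 1) * w * wallis (S (2 * S n)) = PI / 2).
{ rewrite <- (wallis_prod (2 * S n)), mult_INR; simpl (INR 2); unfold w; ring. }
assert (e2 : 2 * INR (S n) * wallis (2 * n + 1) * w = PI / 2).
{ rewrite <- (wallis_prod (2 * n + 1)), plus_INR, mult_INR, S_INR; simpl (INR 2); simpl (INR 1).
  replace (S (2 * n + 1)) with (2 * S n)%nat by lia. unfold w; ring. }
pose proof (wallis_decr (2 * S n)) as d1.
pose proof (wallis_decr (2 * n + 1)) as d2.
replace (S (2 * n + 1)) with (2 * S n)%nat in d2 by lia.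
fold w in p1, d1, d2. set (x := INR (S n)) in *.
split.
- replace (2 * x / (2 * x + 1) * (PI / 4)) with (x / (2 * x + 1) * (PI / 2)) by (field; lra).
  rewrite <- e1.
  replace (x / (2 * x + 1) * ((2 * x + 1) * w * wallis (S (2 * S n))))
    with (x * (w * wallis (S (2 * S n)))) by (field; lra).
  replace (w ^ 2) with (w * w) by ring. apply Rmult_le_compat_l; [lra|]. apply Rmult_le_compat_l; lra.
- assert (x * w ^ 2 <= x * (w * wallis (2 * n + 1))); [|lra].
  replace (w ^ 2) with (w * w) by ring. apply Rmult_le_compat_l; [lra|]. apply Rmult_le_compat_l; lra.
Qed.

Lemma nondecreasing_from_0 (f f' : R -> R) (t : R) : 0 <= t -> f 0 = 0 ->
  (forall x, 0 <= x -> is_derive f x (f' x)) -> (forall x, 0 <= x -> 0 <= f' x) -> 0 <= f t.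
Proof.
intros ht f0 hd hp. destruct (Req_dec t 0) as [->|hn]; [lra|].
destruct (MVT_cor2 f f' 0 t) as [c [e [h1 h2]]]; [lra| |].
- intros c hc; apply is_derive_Reals, hd; lra.
- rewrite f0 in e. assert (0 <= f' c) by (apply hp; lra). nra.
Qed.

(** At t = 1/n the left side is exactly 1/(n + 1/2), the sharp form that makes [stirling]
    nonincreasing. *)
Lemma ln_1_plus_lb (t : R) : 0 <= t -> 2 * t / (2 + t) <= ln (1 + t).
Proof.
intros ht.
assert (h : 0 <= ln (1 + t) - 2 * t / (2 + t)); [|lra].
apply (nondecreasing_from_0 (fun x => ln (1 + x) - 2 * x / (2 + x))
  (fun x => x ^ 2 / ((1 + x) * (2 + x) ^ 2))); [exact ht| | |].
- rewrite Rplus_0_r, ln_1; field.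
- intros x hx; auto_derive; [lra|field; lra].
- intros x hx; apply Rdiv_le_0_compat; [apply pow2_ge_0|].
  apply Rmult_lt_0_compat; [lra|apply pow_lt; lra].
Qed.

Lemma ln_1_plus_ub (t : R) : 0 <= t -> ln (1 + t) <= t - t ^ 2 / 2 + t ^ 3 / 3.
Proof.
intros ht.
assert (h : 0 <= t - t ^ 2 / 2 + t ^ 3 / 3 - ln (1 + t)); [|lra].
apply (nondecreasing_from_0 (fun x => x - x ^ 2 / 2 + x ^ 3 / 3 - ln (1 + x))
  (fun x => x ^ 3 / (1 + x))); [exact ht| | |].
- rewrite Rplus_0_r, ln_1; field.
- intros x hx; auto_derive; [lra|field; lra].
- intros x hx; apply Rdiv_le_0_compat; [apply pow_le; lra|lra].
Qed.

(** The logarithm of n! / (n^(n + 1/2) e^(-n)), whose limit is ln (2 PI) / 2. *)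
Definition stirling (n : nat) : R :=
  ln (INR (fact n)) - (INR n + 1 / 2) * ln (INR n) + INR n.

(** The drop is at most 1/(12 n^2) + 1/(6 n^3) <= 1/(4 n^2); it is stated in telescoping form so
    that it adds up over any range. *)
Lemma stirling_step (n : nat) : (1 <= n)%nat ->
  0 <= stirling n - stirling (S n) <= 1 / 2 * (/ INR n - / INR (S n)).
Proof.
intros hn. assert (h0 : 1 <= INR n) by (apply (le_INR 1); lia).
assert (e : stirling n - stirling (S n) = (INR n + 1 / 2) * ln (1 + / INR n) - 1).
{ unfold stirling. rewrite fact_simpl, mult_INR, ln_mult;
    [|apply lt_0_INR; lia|apply lt_0_INR, lt_O_fact].
  replace (1 + / INR n) with (INR (S n) / INR n) by (rewrite S_INR; field; lra).
  rewrite ln_div; [|apply lt_0_INR; lia|lra].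
  rewrite S_INR; ring. }
rewrite e, S_INR. set (x := INR n) in *.
assert (ht : 0 <= / x) by (left; apply Rinv_0_lt_compat; lra).
pose proof (ln_1_plus_lb _ ht) as lb. pose proof (ln_1_plus_ub _ ht) as ub.
split.
- replace (2 * / x / (2 + / x)) with (/ (x + 1 / 2)) in lb by (field; lra).
  apply (Rmult_le_compat_l (x + 1 / 2)) in lb; [|lra].
  rewrite Rinv_r in lb; lra.
- apply (Rmult_le_compat_l (x + 1 / 2)) in ub; [|lra].
  replace ((x + 1 / 2) * (/ x - (/ x) ^ 2 / 2 + (/ x) ^ 3 / 3))
    with (1 + (/ x) ^ 2 / 12 + (/ x) ^ 3 / 6) in ub by (field; lra).
  replace (/ x - / (x + 1)) with (/ (x * (x + 1))) by (field; lra).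
  assert (/ x <= 1) by (rewrite <- Rinv_1; apply Rinv_le_contravar; lra).
  assert ((/ x) ^ 3 <= (/ x) ^ 2) by (simpl; nra).
  assert ((/ x) ^ 2 / 4 <= 1 / 2 * / (x * (x + 1))); [|lra].
  replace ((/ x) ^ 2 / 4) with (1 / 2 * / (2 * x * x)) by (field; lra).
  apply Rmult_le_compat_l; [lra|]. apply Rinv_le_contravar; nra.
Qed.

Lemma stirling_mono (n m : nat) : (1 <= n)%nat -> (n <= m)%nat ->
  stirling m <= stirling n <= stirling m + 1 / 2 * (/ INR n - / INR m).
Proof.
intros hn hm. induction hm as [|m hm IH]; [lra|].
pose proof (stirling_step m ltac:(lia)). lra.
Qed.

(** Factorials enter this combination only through (n!)^2 / (2n)!, which [wallis_even] evaluates. It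
    has the same limit as [stirling] itself, so it identifies the constant. *)
Lemma stirling_double (n : nat) : (1 <= n)%nat ->
  ln (2 * PI) / 2 <= 2 * stirling n - stirling (2 * n) <= ln (2 * PI) / 2 + / (4 * INR n).
Proof.
intros hn. assert (h0 : 1 <= INR n) by (apply (le_INR 1); lia).
pose proof PI_RGT_0 as hpi.
pose proof (wallis_pos (2 * n)) as [w0 _].
pose proof (wallis_bounds n hn) as [lb ub].
pose proof (wallis_even n) as ev.
assert (f0 : 0 < INR (fact n)) by (apply lt_0_INR, lt_O_fact).
assert (f1 : 0 < INR (fact (2 * n))) by (apply lt_0_INR, lt_O_fact).
assert (p4 : 0 < 4 ^ n) by (apply pow_lt; lra).
apply (f_equal ln) in ev.
assert (f2 : 0 < INR (fact n) ^ 2) by (apply pow_lt; lra).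
assert (f4 : 0 < 4 ^ n * INR (fact n) ^ 2) by (apply Rmult_lt_0_compat; lra).
rewrite !ln_mult, !ln_pow in ev by lra.
simpl (INR 2) in ev.
replace (ln 4) with (2 * ln 2) in ev by (replace 4 with (2 * 2) by lra; rewrite ln_mult; lra).
assert (e : 2 * stirling n - stirling (2 * n) =
  ln (PI / 2) + ln 2 / 2 - (ln (INR n) + 2 * ln (wallis (2 * n))) / 2).
{ unfold stirling; rewrite mult_INR; simpl (INR 2). replace (1 + 1) with 2 in * by ring.
  rewrite ln_mult by lra. lra. }
assert (e2 : ln (INR n) + 2 * ln (wallis (2 * n)) = ln (INR n * wallis (2 * n) ^ 2)).
{ rewrite ln_mult, ln_pow; [simpl (INR 2); ring|lra|lra|apply pow_lt; lra]. }
rewrite e2 in e. clear e2.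
assert (q0 : 0 < 2 * INR n / (2 * INR n + 1)) by (apply Rdiv_lt_0_compat; lra).
assert (u : ln (INR n * wallis (2 * n) ^ 2) <= ln (PI / 4)).
{ apply ln_le; [|exact ub]. apply Rmult_lt_0_compat; [lra|apply pow_lt; lra]. }
assert (l : ln (PI / 4) - / (2 * INR n) <= ln (INR n * wallis (2 * n) ^ 2)).
{ apply Rle_trans with (ln (2 * INR n / (2 * INR n + 1) * (PI / 4))).
  - rewrite ln_mult by lra.
    replace (2 * INR n / (2 * INR n + 1)) with (/ (1 + / (2 * INR n))) by (field; lra).
    assert (hi : 0 < / (2 * INR n)) by (apply Rinv_0_lt_compat; lra).
    rewrite ln_Rinv by lra.
    assert (ln (1 + / (2 * INR n)) <= / (2 * INR n)); [|lra].
    rewrite <- (ln_exp (/ (2 * INR n))) at 2. apply ln_le; [lra|].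
    left; apply exp_ineq1; lra.
  - apply ln_le; [|exact lb]. apply Rmult_lt_0_compat; lra. }
assert (e3 : ln (2 * PI) / 2 = ln (PI / 2) + ln 2 / 2 - ln (PI / 4) / 2).
{ rewrite !ln_div, ln_mult by lra.
  replace (ln 4) with (2 * ln 2) by (replace 4 with (2 * 2) by lra; rewrite ln_mult; lra). lra. }
replace (/ (4 * INR n)) with (/ (2 * INR n) / 2) by (field; lra).
lra.
Qed.

Theorem stirling_bounds (n : nat) : (1 <= n)%nat ->
  0 <= stirling n - ln (2 * PI) / 2 <= / (4 * INR n).
Proof.
intros hn. split.
(* A gap below the constant would persist for every m >= n by monotonicity, but [stirling_double]
   bounds it by the drop from m to 2 m, which tends to 0. *)
- apply Rnot_lt_le; intros hlt.
  destruct (INR_archimed (ln (2 * PI) / 2 - stirling n) 1) as [m0 hm0]; [lra|].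
  set (m := (n + m0)%nat).
  assert (hm : 1 <= INR m) by (apply (le_INR 1); unfold m; lia).
  assert (hm1 : INR m0 <= INR m) by (apply le_INR; unfold m; lia).
  pose proof (stirling_mono n m hn ltac:(unfold m; lia)) as [h1 _].
  pose proof (stirling_mono m (2 * m) ltac:(unfold m; lia) ltac:(lia)) as [_ h2].
  pose proof (stirling_double m ltac:(unfold m; lia)) as [h3 _].
  rewrite mult_INR in h2; simpl (INR 2) in h2.
  assert (hi : 0 < / INR m) by (apply Rinv_0_lt_compat; lra).
  assert (hi2 : 0 < / ((1 + 1) * INR m)) by (apply Rinv_0_lt_compat; lra).
  assert (hc : ln (2 * PI) / 2 - stirling n <= 1 / 2 * / INR m) by lra.
  apply (Rmult_le_compat_r (INR m)) in hc; [|lra].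
  rewrite Rmult_assoc, Rinv_l in hc by lra.
  assert (INR m0 * (ln (2 * PI) / 2 - stirling n) <= INR m * (ln (2 * PI) / 2 - stirling n))
    by (apply Rmult_le_compat_r; lra).
  lra.
- pose proof (stirling_mono n (2 * n) hn ltac:(lia)) as [h1 _].
  pose proof (stirling_double n hn) as [_ h3]. lra.
Qed.

End Stirling.

Module Fourier.
From mathcomp Require Import all_boot all_order all_algebra.
From mathcomp Require Import complex Rstruct.
From mathcomp Require Import zify ring lra.

Set Implicit Arguments.
Unset Strict Implicit.
Unset Printing Implicit Defensive.

Import Order.TTheory GRing.Theory Num.Theory.
Import Normc.
Local Open Scope ring_scope.
Bind Scope ring_scope with R.
Local Arguments cos x%_R.
Local Arguments sin x%_R.
Delimit Scope R_scope with coqR.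
Local Notation C := (R[i]).
Local Notation re := (@complex.Re R).
Local Notation im := (@complex.Im R).

(** * Characters of Z/mZ and the Fourier expansion of balanced counts *)

Definition cis (x : R) : C := (cos (2 * PI * x) +i* sin (2 * PI * x))%C.

Lemma cisD (x y : R) : cis (x + y) = cis x * cis y.
Proof.
rewrite /cis mulrDr cosD sinD; congr (_ +i* _)%C => //.
by rewrite addrC.
Qed.

Lemma cis0 : cis 0 = 1.
Proof. by rewrite /cis mulr0 cos_0 sin_0. Qed.

Lemma cis1 : cis 1 = 1.
Proof. by rewrite /cis mulr1 cos_2PI sin_2PI. Qed.

Lemma cis_nat (n : nat) : cis n%:R = 1.
Proof. by elim: n => [|n IH]; rewrite ?cis0 // -addn1 natrD cisD IH cis1 mul1r. Qed.

Lemma normc_sqrE (z : C) : normc z ^+ 2 = re z ^+ 2 + im z ^+ 2.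
Proof. by case: z => a b; rewrite /= sqr_sqrtr // addr_ge0 // sqr_ge0. Qed.

Lemma normc_ge0 (z : C) : 0 <= normc z.
Proof. by case: z => a b; apply: sqrtr_ge0. Qed.

Lemma normc_cis (x : R) : normc (cis x) = 1.
Proof.
rewrite /cis /=; have -> : cos (2 * PI * x) ^+ 2 + sin (2 * PI * x) ^+ 2 = 1.
  by rewrite addrC; have := sin2_cos2 (2 * PI * x); rewrite /Rsqr !RealsE -!expr2.
by rewrite sqrtr1.
Qed.

Lemma normc_unit_neq0 (z : C) : normc z = 1 -> z != 0.
Proof. by move=> h; apply/eqP => z0; move/eqP: h; rewrite z0 /= expr0n /= addr0 sqrtr0 eq_sym oner_eq0. Qed.

Lemma cis_sum (I : Type) (r : seq I) (Q : pred I) (f : I -> R) :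
  cis (\sum_(i <- r | Q i) f i) = \prod_(i <- r | Q i) cis (f i).
Proof. by apply: (big_morph cis cisD cis0). Qed.

Lemma cisM_nat (x : R) (n : nat) : cis (x * n%:R) = cis x ^+ n.
Proof. by elim: n => [|n IH]; rewrite ?mulr0 ?cis0 // -addn1 natrD mulrDr cisD mulr1 IH exprD expr1. Qed.

Lemma sqr_normc_sub_cis1 (x : R) : normc (cis x - 1) ^+ 2 = 2 * (1 - cos (2 * PI * x)).
Proof.
rewrite normc_sqrE /=.
have : cos (2 * PI * x) ^+ 2 + sin (2 * PI * x) ^+ 2 = 1.
  by rewrite addrC; have := sin2_cos2 (2 * PI * x); rewrite /Rsqr !RealsE -!expr2.
move: (cos _) (sin _) => c s h; rewrite -(subr0 s); nra.
Qed.

Lemma normc_sub_cis1_le (x : R) : normc (cis x - 1) <= 8 * `|x|.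
Proof.
rewrite -(@ler_pXn2r _ 2) ?nnegrE ?normc_ge0 ?mulr_ge0 ?normr_ge0 ?ler0n //.
rewrite sqr_normc_sub_cis1 exprMn real_normK ?num_real //.
have /RleP := one_sub_cos_le (2 * PI * x); rewrite !RealsE.
have /RleP := PI_4; rewrite !RealsE.
have /RltP := PI_RGT_0; rewrite !RealsE.
change (nat_of_pos 4) with 4%N; change (nat_of_pos 2) with 2%N.
move=> hp0 hp; rewrite !expr2; move: (cos _) => c hc.
move: PI hp0 hp hc => p hp0 hp hc.
have : p * p <= 16 by nra.
nra.
Qed.

(** Angles are counted in full turns, so h is the arc divided by 2 PI; this factor absorbs the
    constant of [one_sub_cos_ge]. *)
Lemma unit_lift (z : C) : normc z = 1 -> exists2 h : R, z = cis h & `|h| <= normc (z - 1).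
Proof.
case: z => a b hz.
have hab : a ^+ 2 + b ^+ 2 = 1.
  by have := normc_sqrE (a +i* b)%C; rewrite hz expr1n /= => ->.
have [t [[t1 t2] [tc ts]]] : exists t, (Rle (- PI) t /\ Rle t PI) /\ cos t = a /\ sin t = b.
  by apply: polar; rewrite !RealsE.
have p0 : (PI : R) != 0 by apply/eqP/PI_neq0.
have two0 : (2 : R) != 0 by rewrite pnatr_eq0.
have Et : 2 * PI * (t / (2 * PI)) = t by rewrite mulrC divfK // mulf_neq0.
have Ez : (a +i* b)%C = cis (t / (2 * PI)) by rewrite /cis Et tc ts.
exists (t / (2 * PI)); first exact: Ez.
have /RleP hh := one_sub_cos_ge _ (conj t1 t2).
rewrite -(@ler_pXn2r _ 2) ?nnegrE ?normc_ge0 ?normr_ge0 //.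
rewrite Ez sqr_normc_sub_cis1 Et real_normK ?num_real //.
move: hh; rewrite !RealsE; change (nat_of_pos 2) with 2%N.
have /RltP : Rlt 0 PI by apply: PI_RGT_0.
have : cos t <= 1 by apply/RleP; have [] := COS_bound t.
move: (cos t) PI p0 => c p p0 hc hp hh.
rewrite expr_div_n ler_pdivrMr ?exprn_gt0 ?mulr_gt0 // exprMn.
have : 0 <= (1 - c) * p ^+ 2 by rewrite mulr_ge0 ?sqr_ge0 // subr_ge0.
nra.
Qed.

Lemma cis_cubic (x : R) : 8 * `|x| <= 1 ->
  `|cos (2 * PI * x) - (1 - (2 * PI * x) ^+ 2 / 2)| <= (8 * `|x|) ^+ 3 / 2 /\
  `|sin (2 * PI * x) - 2 * PI * x| <= (8 * `|x|) ^+ 3 / 2.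
Proof.
move=> hx; have hp : (0 : R) < PI by apply/RltP; apply: PI_RGT_0.
have hp4 : PI <= 4 :> R.
  by have /RleP := PI_4; rewrite !RealsE.
have ht : `|2 * PI * x| <= 8 * `|x|.
  by rewrite normrM ler_wpM2r // ger0_norm; lra.
have ht1 := le_trans ht hx.
have ht3 : `|2 * PI * x| ^+ 3 / 2 <= (8 * `|x|) ^+ 3 / 2.
  by rewrite ler_pM2r ?invr_gt0 // lerXn2r // nnegrE // mulr_ge0.
split; apply: le_trans ht3; apply/RleP.
  have := @cos_cubic (2 * PI * x); rewrite !RealsE; apply; exact/RleP.
have := @sin_cubic (2 * PI * x); rewrite !RealsE; apply; exact/RleP.
Qed.

Lemma cis_mod (a m : nat) : (0 < m)%N -> cis ((a %% m)%:R / m%:R) = cis (a%:R / m%:R).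
Proof.
move=> m0; rewrite [in RHS](divn_eq a m) natrD natrM mulrDl mulfK ?pnatr_eq0 -?lt0n //.
by rewrite cisD cis_nat mul1r.
Qed.

Definition chi (m : nat) (x : 'Z_m) : C := cis ((x : nat)%:R / m%:R).

Section Character.
Variables (m : nat) (m1 : (1 < m)%N).
Implicit Types x y : 'Z_m.

Lemma chi_nat (n : nat) : chi (n%:R : 'Z_m) = cis (n%:R / m%:R).
Proof. by rewrite /chi val_Zp_nat // cis_mod // ltnW. Qed.

Lemma chi0 : chi (0 : 'Z_m) = 1.
Proof. by rewrite /chi mul0r cis0. Qed.

Lemma chiD x y : chi (x + y) = chi x * chi y.
Proof. by rewrite -[in LHS](natr_Zp x) -[in LHS](natr_Zp y) -natrD chi_nat natrD mulrDl cisD. Qed.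

Lemma normc_chi x : normc (chi x) = 1.
Proof. exact: normc_cis. Qed.

Lemma chi_neq0 x : chi x != 0.
Proof. exact/normc_unit_neq0/normc_chi. Qed.

Lemma chi_sum (I : Type) (r : seq I) (Q : pred I) (f : I -> 'Z_m) :
  chi (\sum_(i <- r | Q i) f i) = \prod_(i <- r | Q i) chi (f i).
Proof. by apply: (big_morph (@chi m) chiD chi0). Qed.

Lemma chiMn x n : chi (x *+ n) = chi x ^+ n.
Proof. by elim: n => [|n IH]; rewrite ?chi0 // mulrSr exprSr chiD IH. Qed.

(** The distance of chi x from 1 is 2 |sin (PI x / m)|, which is positive for 0 < x < m. *)
Lemma chi_eq1 x : chi x = 1 -> x = 0.
Proof.
move=> h; have m0 : (0 : R) < m%:R by rewrite ltr0n ltnW.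
have xm : (x < m)%N by rewrite -[X in (_ < X)%N](Zp_cast m1) ltn_ord.
have : normc (chi x - 1) ^+ 2 = 0.
  rewrite h subrr; have -> : normc (0 : C) = 0 by exact: normc0.
  by rewrite expr0n.
rewrite sqr_normc_sub_cis1.
have -> : 2 * PI * (x%:R / m%:R) = 2 * (PI * (x%:R / m%:R)) by rewrite mulrA.
set t := PI * _.
have [x0 _|xn0] := eqVneq x 0; first exact: x0.
have x0 : (0 < x)%N by rewrite lt0n; apply: contra xn0 => /eqP h'; apply/eqP/val_inj.
have hp : (0 : R) < PI by apply/RltP; apply: PI_RGT_0.
have t0 : 0 < t by rewrite mulr_gt0 // divr_gt0 // ltr0n.
have t1 : t < PI by rewrite /t gtr_pMr // ltr_pdivrMr // mul1r ltr_nat.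
have /RltP s0 : Rlt 0 (sin t) by apply: sin_gt_0; exact/RltP.
have := cos_2a_sin t; rewrite !RealsE; change (nat_of_pos 2) with 2%N => -> e.
exfalso; suff: 0 < sin t * sin t by move: e; move: (sin t) => s; clear; nra.
by rewrite mulr_gt0.
Qed.

Lemma chi_neq1 x : x != 0 -> chi x != 1.
Proof. by apply: contra => /eqP/chi_eq1/eqP. Qed.

Lemma sum_chi x : \sum_(a : 'Z_m) chi (a * x) = if x == 0 then m%:R else 0.
Proof.
case: eqVneq => [->|xn0].
  under eq_bigr do rewrite mulr0 chi0.
  by rewrite sumr_const cardE size_enum_ord Zp_cast.
set S := \sum_ _ _.
have e : S = chi x * S.
  rewrite /S mulr_sumr [LHS](reindex_inj (addrI 1)) /=.
  by apply: eq_bigr => a _; rewrite mulrDl mul1r chiD.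
have : (chi x - 1) * S = 0 by rewrite mulrBl mul1r -e subrr.
by move/eqP; rewrite mulf_eq0 subr_eq0 (negPf (chi_neq1 xn0)) => /eqP.
Qed.

End Character.

(* [char_term] is the [N]-th power of the characteristic sum of the step
   [(pi p w)_p], twisted so as to select the walks that are [lam]-balanced. *)
Definition char_term (Om P X : finType) (pi : P -> Om -> X) (lam N : nat)
    (u : P -> X -> C) : C :=
  (\sum_(w : Om) \prod_(p : P) u p (pi p w)) ^+ N /
  (\prod_(p : P) \prod_(x : X) u p x) ^+ lam.

Definition balanced (Om P X : finType) (pi : P -> Om -> X) (lam N : nat) :
    pred {ffun 'I_N -> Om} :=
  fun w => [forall p, forall x, #|[pred l | pi p (w l) == x]| == lam].

(** Orthogonality of characters detects each condition that a count equals [lam]. Expanding the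
    product of these sums over all (p, x) produces one frequency F per choice of summation
    indices. *)
Lemma balanced_fourier (Om P X : finType) (pi : P -> Om -> X) (lam N m : nat) :
  (N < m)%N -> (lam < m)%N -> (1 < m)%N ->
  (m ^ #|{: P * X}|)%:R * #|@balanced Om P X pi lam N|%:R =
  \sum_(F : {ffun P * X -> 'Z_m}) char_term pi lam N (fun p x => chi (F (p, x))).
Proof.
move=> Nm lm m1.
pose cnt (w : {ffun 'I_N -> Om}) (q : P * X) := #|[pred l | pi q.1 (w l) == q.2]|.
transitivity (\sum_(w : {ffun 'I_N -> Om}) \prod_(q : P * X)
   \sum_(a : 'Z_m) chi (a * ((cnt w q)%:R - lam%:R))); last first.
  rewrite /char_term; under [RHS]eq_bigr => F _.
    rewrite -[N in _ ^+ N]card_ord -prodr_const bigA_distr_bigA /= mulr_suml.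
    over.
  rewrite exchange_big /=; apply: eq_bigr => w _.
  rewrite bigA_distr_bigA /=; apply: eq_bigr => F _.
  rewrite exchange_big /= [X in _ / X ^+ _](pair_bigA _ (fun p x => chi (F (p, x)))) /=.
  have -> : \prod_(p : P) \prod_(l < N) chi (F (p, pi p (w l))) =
            \prod_(q : P * X) chi (F q) ^+ cnt w q.
    transitivity (\prod_p \prod_x chi (F (p, x)) ^+ cnt w (p, x)); last first.
      by rewrite pair_bigA; apply: eq_bigr => -[].
    apply: eq_bigr => p _.
    rewrite (partition_big (fun l => pi p (w l)) predT) //=.
    apply: eq_bigr => x _; rewrite /cnt /= -prodr_const; apply: eq_big => // l.
    by move/eqP ->.
  rewrite -prodrXl -prodf_div; apply: eq_bigr => -[p x] _ /=.
  rewrite mulrBr chiD // !mulr_natr chiMn // -mulNrn chiMn // -exprVn; congr (_ * _ ^+ _).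
  have h := chi_neq0 (F (p, x)); apply: (mulIf h).
  by rewrite -chiD // addNr chi0 mulVf.
rewrite mulr_natr -sumr_const big_mkcond /=; apply: eq_bigr => w _.
under eq_bigr do rewrite sum_chi //.
(* Counts are at most N, and both N and lam are below m, so congruence modulo m is equality. *)
have E q : ((cnt w q)%:R - lam%:R == 0 :> 'Z_m) = (cnt w q == lam).
  rewrite subr_eq0; apply/eqP/eqP => [h|-> //].
  have hc : (cnt w q < m)%N.
    by apply: leq_ltn_trans Nm; rewrite -[N in (_ <= N)%N]card_ord max_card.
  by have := congr1 val h; rewrite /= !val_Zp_nat // !modn_small.
case: ifP => [hb|/negbT].
  rewrite natrX -prodr_const; apply: eq_bigr => -[p x] _; rewrite E.
  by move/forallP: hb => /(_ p)/forallP/(_ x) ->.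
case/forallPn => p /forallPn [x hpx].
by rewrite (bigD1 (p, x)) //= E (negPf hpx) mul0r.
Qed.

(** * Frequencies near a trivial character *)

Lemma re_sum (I : Type) (r : seq I) (Q : pred I) (f : I -> C) :
  re (\sum_(i <- r | Q i) f i) = \sum_(i <- r | Q i) re (f i).
Proof. by apply: (big_morph re) => // -[a b] [c d]. Qed.

Lemma im_sum (I : Type) (r : seq I) (Q : pred I) (f : I -> C) :
  im (\sum_(i <- r | Q i) f i) = \sum_(i <- r | Q i) im (f i).
Proof. by apply: (big_morph im) => // -[a b] [c d]. Qed.

Lemma reB (x y : C) : re (x - y) = re x - re y.
Proof. by case: x y => a b [c d]. Qed.

Lemma imB (x y : C) : im (x - y) = im x - im y.
Proof. by case: x y => a b [c d]. Qed.

Lemma normc_le_re_im (z : C) : normc z <= `|re z| + `|im z|.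
Proof.
rewrite -(@ler_pXn2r _ 2) ?nnegrE ?normc_ge0 ?addr_ge0 //.
rewrite normc_sqrE -(real_normK (num_real (re z))) -(real_normK (num_real (im z))).
have := normr_ge0 (re z); have := normr_ge0 (im z).
move: `|re z| `|im z| => a b *; nra.
Qed.

Lemma normc_real (x : R) : normc (x%:C)%C = `|x|.
Proof. by rewrite /= expr0n addr0 sqrtr_sqr. Qed.

Lemma normcX (z : C) n : normc (z ^+ n) = normc z ^+ n.
Proof. by elim: n => [|n IH]; rewrite ?expr0 ?normc1 // !exprS normcM IH. Qed.

Lemma normc_prod (I : Type) (r : seq I) (Q : pred I) (f : I -> C) :
  normc (\prod_(i <- r | Q i) f i) = \prod_(i <- r | Q i) normc (f i).
Proof. by apply: (big_morph (@normc R) (@normcM R) (normc1 R)). Qed.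

Lemma normc_sum_le (I : Type) (r : seq I) (Q : pred I) (f : I -> C) :
  normc (\sum_(i <- r | Q i) f i) <= \sum_(i <- r | Q i) normc (f i).
Proof.
elim/big_rec2: _ => [|i y x _ h]; first by rewrite normc0.
by apply: le_trans (le_normcD _ _) _; rewrite lerD2l.
Qed.

Lemma normc_distC (x y : C) : normc (x - y) = normc (y - x).
Proof. by rewrite -[y - x]opprB normcN. Qed.

Lemma normc_expn_sub1 (z : C) (t : R) N : normc z <= t ->
  normc ((1 + z) ^+ N - 1) <= (1 + t) ^+ N - 1.
Proof.
move=> h; have t0 : 0 <= t := le_trans (normc_ge0 _) h.
elim: N => [|N IH]; first by rewrite !expr0 !subrr normc0.
have -> : (1 + z) ^+ N.+1 - 1 = (1 + z) * ((1 + z) ^+ N - 1) + z.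
  by rewrite exprS; ring.
have -> : (1 + t) ^+ N.+1 - 1 = (1 + t) * ((1 + t) ^+ N - 1) + t.
  by rewrite exprS; ring.
apply: le_trans (le_normcD _ _) _; rewrite normcM lerD //.
rewrite ler_pM ?normc_ge0 //.
by apply: le_trans (le_normcD _ _) _; rewrite normc1 lerD2l.
Qed.

(** A relative error: dividing by s >= 1/2 at most doubles t, hence the [2 * t] in the
    hypothesis. *)
Lemma normc_expn_sub (z : C) (s t e : R) N :
  normc (z - (s%:C)%C) <= t -> 1 / 2 <= s -> (1 + 2 * t) ^+ N <= 1 + e ->
  normc (z ^+ N - ((s ^+ N)%:C)%C) <= e * s ^+ N.
Proof.
move=> h hs he; have s0 : 0 < s by lra.
have sC : (s%:C)%C != 0 :> C by rewrite eq_complex /= eqxx andbT gt_eqF.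
pose y := (z - (s%:C)%C) / (s%:C)%C.
have -> : z = (s%:C)%C * (1 + y) by rewrite /y mulrDr mulr1 mulrC divfK // addrC subrK.
have hy : normc y <= 2 * t.
  rewrite /y normcM normcV normc_real gtr0_norm // ler_pdivrMr //.
  have := normc_ge0 (z - (s%:C)%C); nra.
have -> : ((s%:C)%C * (1 + y)) ^+ N - ((s ^+ N)%:C)%C = ((s ^+ N)%:C)%C * ((1 + y) ^+ N - 1) :> C.
  by rewrite exprMn rmorphXn mulrBr mulr1.
have sN : 0 <= s ^+ N by rewrite exprn_ge0 // ltW.
rewrite normcM normc_real ger0_norm // mulrC; apply: ler_wpM2r => //.
by apply: le_trans (normc_expn_sub1 _ hy) _; rewrite lerBlDl.
Qed.

(** * Uniform, pairwise independent projections *)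

Section Shift.
Variables (g : nat) (g1 : (1 < g)%N) (Om P : finType) (pi : P -> Om -> 'Z_g).

Definition shiftable : Prop := forall p q : P,
  exists2 tau : 'Z_g -> Om -> Om, (forall t, injective (tau t)) &
    forall t w, pi p (tau t w) = pi p w + t /\ (q != p -> pi q (tau t w) = pi q w).

Hypothesis sh : shiftable.

Lemma card_Zg : #|'Z_g| = g.
Proof. by rewrite card_ord Zp_cast. Qed.

Lemma shift_mean p (h : 'Z_g -> R) :
  g%:R * \sum_w h (pi p w) = #|Om|%:R * \sum_x h x.
Proof.
have [tau ti tE] := sh p p.
transitivity (\sum_(t : 'Z_g) \sum_w h (pi p (tau t w))).
  rewrite mulr_natl -[in LHS]card_Zg -sumr_const; apply: eq_bigr => t _.
  by rewrite (reindex_inj (ti t)).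
rewrite exchange_big /= mulr_natl -sumr_const; apply: eq_big => // w _.
rewrite [RHS](reindex_inj (addrI (pi p w))) /=.
by apply: eq_bigr => t _; have [-> _] := tE t w.
Qed.

Lemma shift_orthogonal p q (h h' : 'Z_g -> R) : q != p -> \sum_x h x = 0 ->
  \sum_w h (pi p w) * h' (pi q w) = 0.
Proof.
move=> qp h0; have [tau ti tE] := sh p q.
have : g%:R * \sum_w h (pi p w) * h' (pi q w) = 0.
  transitivity (\sum_(t : 'Z_g) \sum_w h (pi p (tau t w)) * h' (pi q (tau t w))).
    rewrite mulr_natl -[in LHS]card_Zg -sumr_const; apply: eq_bigr => t _.
    by rewrite [LHS](reindex_inj (ti t)).
  rewrite exchange_big /= big1 // => w _.
  under eq_bigr => t _ do rewrite (proj1 (tE t w)) (proj2 (tE t w) qp).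
  rewrite -mulr_suml -[X in X * _](reindex_inj (addrI (pi p w)) (F := h) (P := predT)) /=.
  by rewrite h0 mul0r.
move/eqP; rewrite mulf_eq0 pnatr_eq0 => /orP[/eqP g0|/eqP //].
by move: g1; rewrite g0.
Qed.

(** Pairwise independence kills the cross terms, so the normalised variance is a function of f alone
    and does not see the system. *)
Lemma shift_variance (f : P -> 'Z_g -> R) : (forall p, \sum_x f p x = 0) ->
  \sum_w (\sum_p f p (pi p w)) ^+ 2 = #|Om|%:R * (\sum_p \sum_x f p x ^+ 2) / g%:R.
Proof.
move=> f0; have g0 : (g%:R : R) != 0 by rewrite pnatr_eq0 -lt0n ltnW.
apply: (mulIf g0); rewrite divfK // mulrC.
transitivity (g%:R * \sum_p \sum_w f p (pi p w) ^+ 2).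
  congr (_ * _); under eq_bigr do rewrite expr2 mulr_suml.
  rewrite exchange_big /=; apply: eq_bigr => p _.
  under eq_bigr do rewrite mulr_sumr.
  rewrite exchange_big /= (bigD1 p) //= [X in _ + X]big1 ?addr0.
    by apply: eq_bigr => w _; rewrite expr2.
  by move=> q qp; rewrite shift_orthogonal.
rewrite !mulr_sumr; apply: eq_bigr => p _.
by rewrite (shift_mean p (fun x => f p x ^+ 2)).
Qed.

(** Taylor expansion to second order: the linear part sums to 0 because each [f p] is centred, and
    [shift_variance] gives the quadratic part. Real and imaginary parts each contribute half of the
    error. *)
Lemma char_sum_near (f : P -> 'Z_g -> R) (d : R) :
  (forall p x, `|f p x| <= d) -> (forall p, \sum_x f p x = 0) ->
  8 * (#|P|%:R * d) <= 1 ->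
  normc (\sum_w cis (\sum_p f p (pi p w)) -
         ((#|Om|%:R * (1 - (2 * PI) ^+ 2 / 2 * ((\sum_p \sum_x f p x ^+ 2) / g%:R)))%:C)%C)
    <= #|Om|%:R * (8 * (#|P|%:R * d)) ^+ 3.
Proof.
move=> fd f0 nd; pose F w := \sum_p f p (pi p w).
have hF w : `|F w| <= #|P|%:R * d.
  apply: le_trans (ler_norm_sum _ _ _) _; rewrite mulr_natl -sumr_const.
  by apply: ler_sum.
have hF8 w : 8 * `|F w| <= 8 * (#|P|%:R * d) by rewrite ler_wpM2l.
have hF3 w : (8 * `|F w|) ^+ 3 / 2 <= (8 * (#|P|%:R * d)) ^+ 3 / 2.
  have nd0 : 0 <= #|P|%:R * d by apply: le_trans (hF w).
  by rewrite ler_pM2r ?invr_gt0 // lerXn2r // nnegrE mulr_ge0.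
have ct w := cis_cubic (le_trans (hF8 w) nd).
set e3 := (8 * _) ^+ 3 in hF3 *.
apply: le_trans (normc_le_re_im _) _.
have sumc (c : R) : \sum_(w : Om) c = #|Om|%:R * c by rewrite sumr_const mulr_natl.
have -> : #|Om|%:R * e3 = \sum_(w : Om) (e3 / 2) + \sum_(w : Om) (e3 / 2).
  by rewrite sumc; lra.
rewrite reB imB /= re_sum im_sum subr0.
apply: lerD.
  have -> : #|Om|%:R * (1 - (2 * PI) ^+ 2 / 2 * ((\sum_p \sum_x f p x ^+ 2) / g%:R)) =
            \sum_w (1 - (2 * PI * F w) ^+ 2 / 2).
    rewrite sumrB sumr_const mulrBr mulr1; congr (_ - _).
    transitivity ((2 * PI) ^+ 2 / 2 * \sum_w (F w) ^+ 2).
      by rewrite /F shift_variance //; ring.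
    by rewrite mulr_sumr; apply: eq_bigr => w _; rewrite exprMn; ring.
  rewrite -sumrB; apply: le_trans (ler_norm_sum _ _ _) _.
  by apply: ler_sum => w _; apply: le_trans (hF3 w); exact: (ct w).1.
have E : \sum_w 2 * PI * F w = 0.
  rewrite -mulr_sumr /F exchange_big /= big1 ?mulr0 // => p _.
  have g0 : (g%:R : R) != 0 by rewrite pnatr_eq0 -lt0n ltnW.
  by apply: (mulfI g0); rewrite shift_mean f0 !mulr0.
rewrite -[X in `|X|]subr0 -[X in _ - X]E -sumrB.
apply: le_trans (ler_norm_sum _ _ _) _.
by apply: ler_sum => w _; apply: le_trans (hF3 w); exact: (ct w).2.
Qed.

End Shift.

(** With exponent N = |X| lam numerator and denominator have the same degree in each [u p]. This
    freedom is what allows phases to be centred. *)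
Lemma char_term_scale (Om P X : finType) (pi : P -> Om -> X) (lam : nat)
    (c : P -> C) (u : P -> X -> C) : (forall p, c p != 0) ->
  char_term pi lam (#|X| * lam) (fun p x => c p * u p x) =
  char_term pi lam (#|X| * lam) u.
Proof.
move=> c0; rewrite /char_term.
have -> : \sum_w \prod_p (c p * u p (pi p w)) = (\prod_p c p) * \sum_w \prod_p u p (pi p w).
  by rewrite mulr_sumr; apply: eq_bigr => w _; rewrite big_split.
have -> : \prod_p \prod_x (c p * u p x) = (\prod_p c p) ^+ #|X| * \prod_p \prod_x u p x.
  rewrite -prodrXl -big_split /=; apply: eq_bigr => p _.
  by rewrite big_split /= prodr_const.
have h : (\prod_p c p) ^+ (#|X| * lam) != 0 by rewrite expf_neq0 //; apply/prodf_neq0.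
by rewrite !exprMn -exprM invfM mulrACA mulfV // mul1r.
Qed.

Definition normalized_term (Om P X : finType) (pi : P -> Om -> X) (lam N : nat)
    (u : P -> X -> C) : C := char_term pi lam N u / #|Om|%:R ^+ N.

Lemma real_complex_nat (n : nat) : (n%:R : C) = ((n%:R : R)%:C)%C.
Proof. by rewrite rmorph_nat. Qed.

(** The order of quantifiers is the point: s is built from u before [Om] and [pi] are given, so two
    different systems share it. *)
Lemma normalized_term_near (g lam : nat) (P : finType) (d e : R) (u : P -> 'Z_g -> C) :
  (1 < g)%N -> (forall p x, normc (u p x) = 1) ->
  (forall p x, normc (u p x / u p 0 - 1) <= d) ->
  64 * (#|P|%:R * d) <= 1 ->
  (1 + 2 * (16 * (#|P|%:R * d)) ^+ 3) ^+ (g * lam) <= 1 + e ->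
  exists2 s : R, 0 <= s & forall (Om : finType) (pi : P -> Om -> 'Z_g),
    shiftable pi -> (0 < #|Om|)%N ->
    normc (normalized_term pi lam (g * lam) u - (s%:C)%C) <= e * s.
Proof.
move=> g1 u1 ud nd he.
have g0 : (g%:R : R) != 0 by rewrite pnatr_eq0 -lt0n ltnW.
have gp : (0 : R) < g%:R by rewrite ltr0n ltnW.
have u0 p x : u p x != 0 by exact: normc_unit_neq0.
have lift (q : P * 'Z_g) : exists2 h : R, u q.1 q.2 / u q.1 0 = cis h & `|h| <= d.
  have [|h hE hd] := @unit_lift (u q.1 q.2 / u q.1 0).
    by rewrite normcM normcV !u1 invr1 mulr1.
  by exists h => //; apply: le_trans hd (ud _ _).
have [h hE hd] := fin_all_exists2 lift.
(* Centring the phases moves [cis (mean p)] into the scalar [c p], which the term ignores, and at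
   most doubles the bound d; hence 16 = 8 * 2 in the error. *)
pose mean p := (\sum_x h (p, x)) / g%:R.
pose f p x := h (p, x) - mean p.
have sum_const (c : R) : \sum_(x : 'Z_g) c = g%:R * c by rewrite sumr_const card_Zg // mulr_natl.
have md p : `|mean p| <= d.
  rewrite /mean normrM (@ger0_norm _ g%:R^-1) ?invr_ge0 ?ler0n //.
  rewrite ler_pdivrMr //.
  apply: le_trans (ler_norm_sum _ _ _) _; rewrite mulrC -sum_const.
  by apply: ler_sum.
have f0 p : \sum_x f p x = 0.
  by rewrite /f sumrB sum_const /mean [_ * (_ / _)]mulrC divfK // subrr.
have fd p x : `|f p x| <= 2 * d.
  by apply: le_trans (ler_normB _ _) _; have := hd (p, x); have := md p; lra.
pose c p := u p 0 * cis (mean p).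
have c0 p : c p != 0 by rewrite mulf_neq0 ?u0 //; apply/normc_unit_neq0/normc_cis.
have uE p x : u p x = c p * cis (f p x).
  by rewrite /c -mulrA -cisD /f addrC subrK -(hE (p, x)) /= mulrC divfK ?u0.
have nd2 : 8 * (#|P|%:R * (2 * d)) <= 1 by lra.
pose V := (\sum_p \sum_x f p x ^+ 2) / g%:R.
pose s := 1 - (2 * PI) ^+ 2 / 2 * V.
(* With y = |P| d <= 1/64 one has V <= 4 y^2 <= 1/1024, and 2 PI^2 <= 32. The empty P is split off
   since it gives neither |P| >= 1 nor 0 <= d. *)
have hs : 1 / 2 <= s.
  have hp : (0 : R) < PI by apply/RltP; apply: PI_RGT_0.
  have hp4 : (PI : R) <= 4 by have /RleP := PI_4; rewrite !RealsE.
  have hp16 : (2 * PI) ^+ 2 / 2 <= 32.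
    have -> : (2 * PI) ^+ 2 / 2 = 2 * (PI * PI) by field.
    have : (PI : R) * PI <= 16 by nra.
    lra.
  have V0 : 0 <= V by rewrite divr_ge0 ?sumr_ge0 // => p _; rewrite sumr_ge0 // => x _; rewrite sqr_ge0.
  have [P0|P0] := posnP #|P|.
    have -> : s = 1 by rewrite /s /V big1 ?mul0r ?mulr0 ?subr0 // => p; case: (fintype0 p).
    by lra.
  have n1 : 1 <= (#|P|%:R : R) by rewrite ler1n.
  have /card_gt0P[p _] := P0.
  have d0 : 0 <= d by apply: le_trans (md p).
  have VV : V <= #|P|%:R * (2 * d) ^+ 2.
    rewrite ler_pdivrMr // -mulrA.
    have -> : #|P|%:R * ((2 * d) ^+ 2 * g%:R) = \sum_(q : P) (2 * d) ^+ 2 * g%:R.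
      by rewrite sumr_const mulr_natl.
    apply: ler_sum => q _.
    rewrite mulrC -sum_const; apply: ler_sum => x _.
    by rewrite -real_normK ?num_real // lerXn2r // nnegrE ?mulr_ge0.
  have : #|P|%:R * (2 * d) ^+ 2 <= 4 * (#|P|%:R * d) * (#|P|%:R * d).
    by rewrite expr2; move: (#|P|%:R : R) n1 => n n1; nra.
  have : 0 <= #|P|%:R * d by rewrite mulr_ge0.
  rewrite /s; move: (#|P|%:R * d) nd => y nd y0 hy.
  have : V <= 1 / 1024 by nra.
  by move: ((2 * PI) ^+ 2 / 2) hp16 => q *; nra.
exists (s ^+ (g * lam)); first by rewrite exprn_ge0 //; lra.
move=> Om pi sh Om0.
have -> : normalized_term pi lam (g * lam) u =
    ((\sum_w cis (\sum_p f p (pi p w))) / #|Om|%:R) ^+ (g * lam).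
  rewrite /normalized_term exprMn exprVn; congr (_ / _).
  transitivity (char_term pi lam (#|'Z_g| * lam) (fun p x => c p * cis (f p x))).
    by rewrite card_Zg // /char_term; congr (_ ^+ _ / _ ^+ _);
      apply: eq_bigr => w _; apply: eq_bigr => p _; rewrite uE.
  rewrite char_term_scale // /char_term card_Zg //.
  rewrite [X in _ / X ^+ _]big1 ?expr1n ?divr1; last first.
    by move=> p _; rewrite -cis_sum f0 cis0.
  by congr (_ ^+ _); apply: eq_bigr => w _; rewrite cis_sum.
have O0 : (0 : R) < #|Om|%:R by rewrite ltr0n.
apply: normc_expn_sub he => //.
have := @char_sum_near g g1 Om P pi sh f (2 * d) fd f0 nd2.
rewrite -/V -/s; set S := \sum_w _ => hS.
have OC : (#|Om|%:R : C) != 0 by rewrite pnatr_eq0 -lt0n.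
have -> : S / #|Om|%:R - (s%:C)%C = (S - ((#|Om|%:R * s)%:C)%C) / #|Om|%:R :> C.
  by rewrite rmorphM /= -real_complex_nat mulrBl [_ * (s%:C)%C]mulrC mulfK.
rewrite normcM normcV real_complex_nat normc_real ger0_norm ?ler0n // ler_pdivrMr // [X in _ <= X]mulrC.
by apply: le_trans hS _; rewrite (_ : 8 * (#|P|%:R * (2 * d)) = 16 * (#|P|%:R * d)) //; lra.
Qed.

(** * Frequencies far from every annihilator *)

Lemma normc_prod_sub (I : eqType) (r : seq I) (x y : I -> C) :
  (forall i, normc (x i) = 1) -> (forall i, normc (y i) = 1) ->
  normc (\prod_(i <- r) x i - \prod_(i <- r) y i) <= \sum_(i <- r) normc (x i - y i).
Proof.
move=> hx hy; elim: r => [|i r IH]; first by rewrite !big_nil subrr normc0.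
rewrite !big_cons.
have -> : x i * \prod_(j <- r) x j - y i * \prod_(j <- r) y j =
   (x i - y i) * \prod_(j <- r) x j + y i * (\prod_(j <- r) x j - \prod_(j <- r) y j).
  by ring.
apply: le_trans (le_normcD _ _) _; rewrite !normcM hy mul1r.
by rewrite normc_prod (eq_bigr (fun=> 1)) // big1 // mulr1 lerD2l.
Qed.

Lemma normcX_sub1 (z : C) n : normc z = 1 -> normc (z ^+ n - 1) <= n%:R * normc (z - 1).
Proof.
move=> hz; elim: n => [|n IH]; first by rewrite expr0 subrr normc0 mul0r.
have -> : z ^+ n.+1 - 1 = z * (z ^+ n - 1) + (z - 1) by rewrite exprS; ring.
apply: le_trans (le_normcD _ _) _; rewrite normcM hz mul1r -addn1 natrD mulrDl mul1r.
by rewrite lerD2r.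
Qed.

Lemma chi_primitive g : (1 < g)%N -> g.-primitive_root (chi (1 : 'Z_g)).
Proof.
move=> g1; rewrite /primitive_root_of_unity ltnW //=; apply/forallP => i.
rewrite unity_rootE -chiMn //; apply/eqP; case: (i.+1 =P g) => [->|hi].
  by apply/eqP; rewrite -[1 *+ g]/(g%:R) pchar_Zp // chi0.
apply/negbTE/chi_neq1 => //; rewrite -[1 *+ _]/(i.+1%:R); apply/eqP => /(congr1 val).
rewrite /= val_Zp_nat // modn_small // ltn_neqAle ltn_ord andbT; exact/eqP.
Qed.

(** Induction gives U(n) close to U(1)^n, so U(1)^g is within g k of 1. Dividing U(1) by a small
    rotation [cis t] gives an exact g-th root of unity, that is, a character. The induction costs g
    k and the rotation 8 g k. *)
Lemma near_character g (U : 'Z_g -> C) (k : R) : (1 < g)%N ->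
  U 0 = 1 -> (forall x, normc (U x) = 1) ->
  (forall x y, normc (U (x + y) - U x * U y) <= k) ->
  exists a : 'Z_g, forall x, normc (U x / chi (a * x) - 1) <= 9 * (g%:R * k).
Proof.
move=> g1 U0 U1 Uk.
have gp : (0 : R) < g%:R by rewrite ltr0n ltnW.
have k0 : 0 <= k by apply: le_trans (Uk 0 0); apply: normc_ge0.
have UX n : normc (U n%:R - U 1 ^+ n) <= n%:R * k.
  elim: n => [|n IH]; first by rewrite U0 expr0 subrr normc0 mul0r.
  have -> : U n.+1%:R - U 1 ^+ n.+1 =
     (U (n%:R + 1) - U n%:R * U 1) + U 1 * (U n%:R - U 1 ^+ n).
    by rewrite -[n.+1]addn1 natrD exprD expr1; ring.
  apply: le_trans (le_normcD _ _) _; rewrite normcM U1 mul1r -addn1 natrD mulrDl mul1r addrC.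
  by rewrite lerD.
have [h hE hk] : exists2 h : R, U 1 ^+ g = cis h & `|h| <= g%:R * k.
  have [|h hE hk] := @unit_lift (U 1 ^+ g); first by rewrite normcX U1 expr1n.
  exists h => //; apply: le_trans hk _; rewrite normc_distC -U0 -(pchar_Zp g1); exact: UX.
pose t := h / g%:R.
pose z := U 1 / cis t.
have zg : z ^+ g = 1.
  rewrite /z exprMn exprVn -cisM_nat /t divfK ?gt_eqF // hE mulfV //.
  exact/normc_unit_neq0/normc_cis.
have [i zE] := prim_rootP (chi_primitive g1) zg.
exists (i%:R) => x.
have -> : chi (i%:R * x) = z ^+ (x : nat).
  by rewrite -{1}(natr_Zp x) mulr_natr chiMn // zE -(chiMn g1 1).
have z1 : normc z = 1 by rewrite /z normcM normcV U1 normc_cis invr1 mulr1.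
have zx0 : z ^+ (x : nat) != 0 by rewrite expf_neq0 //; exact: normc_unit_neq0.
have -> : U x / z ^+ (x : nat) - 1 = (U x - z ^+ (x : nat)) / z ^+ (x : nat).
  by rewrite mulrBl mulfV.
rewrite normcM normcV normcX z1 expr1n invr1 mulr1.
have -> : U x - z ^+ (x : nat) = (U (x : nat)%:R - U 1 ^+ (x : nat)) +
    z ^+ (x : nat) * (cis t ^+ (x : nat) - 1).
  have -> : U 1 ^+ (x : nat) = z ^+ (x : nat) * cis t ^+ (x : nat).
    by rewrite -exprMn /z divfK //; exact/normc_unit_neq0/normc_cis.
  by rewrite natr_Zp mulrBr mulr1 addrA subrK.
apply: le_trans (le_normcD _ _) _; rewrite normcM normcX z1 expr1n mul1r.
have xg : ((x : nat)%:R : R) <= g%:R.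
  by rewrite ler_nat -[X in (_ <= X)%N](card_Zg g1) card_ord ltnW.
have h1 := UX x.
have h2 : normc (cis t ^+ (x : nat) - 1) <= g%:R * (8 * `|t|).
  apply: le_trans (normcX_sub1 _ (normc_cis _)) _.
  by rewrite ler_pM ?ler0n ?normc_ge0 // normc_sub_cis1_le.
have h3 : g%:R * `|t| <= g%:R * k.
  by rewrite /t normrM (@ger0_norm _ g%:R^-1) ?invr_ge0 ?ler0n // mulrC divfK ?gt_eqF.
have h4 : (x : nat)%:R * k <= g%:R * k by rewrite ler_wpM2r.
have -> : 9 * (g%:R * k) = g%:R * k + 8 * (g%:R * k) by ring.
apply: lerD; first exact: le_trans h1 h4.
by apply: le_trans h2 _; rewrite mulrCA ler_wpM2l.
Qed.

Lemma unit_variance (Om : finType) (u : Om -> C) (phi : C) : (forall w, normc (u w) = 1) ->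
  \sum_w u w = #|Om|%:R * phi ->
  \sum_w normc (u w - phi) ^+ 2 = #|Om|%:R * (1 - normc phi ^+ 2).
Proof.
move=> u1 hu.
have sumc (c : R) : \sum_(w : Om) c = #|Om|%:R * c by rewrite sumr_const mulr_natl.
have hre : \sum_w re (u w) = #|Om|%:R * re phi.
  by rewrite -re_sum hu real_complex_nat; case: phi {hu} => a b /=; rewrite mul0r subr0.
have him : \sum_w im (u w) = #|Om|%:R * im phi.
  by rewrite -im_sum hu real_complex_nat; case: phi {hu hre} => a b /=; rewrite mul0r addr0.
transitivity (\sum_w (1 + normc phi ^+ 2 - 2 * re phi * re (u w) - 2 * im phi * im (u w))).
  apply: eq_bigr => w _.
  have := normc_sqrE (u w); rewrite u1 expr1n !normc_sqrE reB imB => h.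
  by rewrite {1}h; ring.
rewrite !sumrB sumc -!mulr_sumr hre him normc_sqrE; ring.
Qed.

Section Separated.
Variables (g : nat) (g1 : (1 < g)%N) (I P : finType).
Variable pi : P -> {ffun I -> 'Z_g} -> 'Z_g.
Local Notation Om := {ffun I -> 'Z_g}.

(* Every other projection is killed by one of the two directions, so the mixed
   second difference of [\prod_q u q (pi q w)] along them only sees [u p]. *)
Definition separated : Prop :=
  (forall p v w, pi p (v + w) = pi p v + pi p w) /\
  forall p, exists e1 e2 : 'Z_g -> Om,
    [/\ forall s, pi p (e1 s) = s, forall s, pi p (e2 s) = s &
        forall q, q != p -> (forall s, pi q (e1 s) = 0) \/ (forall s, pi q (e2 s) = 0)].

Hypothesis sep : separated.

Lemma separatedD p v w : pi p (v + w) = pi p v + pi p w.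
Proof. exact: sep.1. Qed.

Lemma separated_shiftable : shiftable pi.
Proof.
move=> p q; have [e1 [e2 [h1 h2 h]]] := sep.2 p.
have key (e : 'Z_g -> Om) : (forall s, pi p (e s) = s) ->
  (q != p -> forall s, pi q (e s) = 0) ->
  exists2 tau : 'Z_g -> Om -> Om, (forall t, injective (tau t)) &
    forall t w, pi p (tau t w) = pi p w + t /\ (q != p -> pi q (tau t w) = pi q w).
  move=> he hq; exists (fun t w => w + e t); first by move=> t; apply: addIr.
  move=> t w; rewrite !separatedD he; split => // qp.
  by rewrite hq // addr0.
have [qp|qp] : q == p \/ q != p by case: (q == p); [left|right].
  by apply: (key e1) => //; rewrite qp.
by case: (h q qp) => h'; [apply: (key e1)|apply: (key e2)].
Qed.

Lemma card_Om_gt0 : (0 < #|{: Om}|)%N.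
Proof. by apply/card_gt0P; exists 0. Qed.

Variable u : P -> 'Z_g -> C.
Hypothesis u1 : forall p x, normc (u p x) = 1.

Let phi : C := (\sum_w \prod_p u p (pi p w)) / #|{: Om}|%:R.

(** If the mean phi is near the unit circle, f is near phi for most w, so its mixed second
    difference is near 1; by separation this is the mixed difference of [u p]. The 16 is 4 from the
    square of a sum of four deviations times 4 for their number; g is the inverse density of the
    slice [pi p w = 0]. *)
Lemma mixed_difference p s t :
  normc (u p 0 * u p (s + t) / (u p s * u p t) - 1) ^+ 2 <= 16 * (g%:R * (1 - normc phi ^+ 2)).
Proof.
have [e1 [e2 [h1 h2 h]]] := sep.2 p.
have u0 q x : u q x != 0 by exact: normc_unit_neq0.
pose f w := \prod_q u q (pi q w).
have f1 w : normc (f w) = 1 by rewrite /f normc_prod big1.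
have f0 w : f w != 0 by exact: normc_unit_neq0.
have O0 : (#|{: Om}|%:R : C) != 0 by rewrite pnatr_eq0 -lt0n card_Om_gt0.
have var := @unit_variance _ f phi f1.
have {}var : \sum_w normc (f w - phi) ^+ 2 = #|{: Om}|%:R * (1 - normc phi ^+ 2).
  by apply: var; rewrite /phi mulrC divfK.
have fE w : f w * f (w + e1 s + e2 t) / (f (w + e1 s) * f (w + e2 t)) =
    u p (pi p w) * u p (pi p w + s + t) / (u p (pi p w + s) * u p (pi p w + t)).
  rewrite /f -!big_split -prodf_div /= (bigD1 p) //= [X in _ * X]big1 ?mulr1.
    by rewrite !separatedD h1 h2.
  move=> q qp; rewrite !separatedD.
  case: (h q qp) => ->; rewrite ?addr0.
    by rewrite mulfV // mulf_neq0.
  by rewrite [X in _ / X]mulrC mulfV // mulf_neq0.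
set D := _ - 1.
(* On the slice [pi p w = 0] the quotient takes the fixed value in the statement; elsewhere the left
   side is set to 0. *)
have bound w : (if pi p w == 0 then normc D ^+ 2 else 0) <=
    4 * (normc (f w - phi) ^+ 2 + normc (f (w + e1 s) - phi) ^+ 2 +
         (normc (f (w + e2 t) - phi) ^+ 2 + normc (f (w + e1 s + e2 t) - phi) ^+ 2)).
  case: eqP => [w0|_]; last first.
    by rewrite mulr_ge0 ?ler0n // !addr_ge0 // sqr_ge0.
  have -> : normc D = normc (f w * f (w + e1 s + e2 t) - f (w + e1 s) * f (w + e2 t)).
    have := fE w; rewrite w0 !add0r => e.
    rewrite /D -e -[X in _ / _ - X](mulfV (mulf_neq0 (f0 (w + e1 s)) (f0 (w + e2 t)))) -mulrBl.
    by rewrite normcM normcV !normcM !f1 !mulr1 invr1 mulr1.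
  set a := f w; set b := f (w + e1 s); set c := f (w + e2 t); set d := f _.
  have -> : a * d - b * c = d * ((a - phi) - (b - phi)) + b * ((d - phi) - (c - phi)) by ring.
  have h' : normc (d * ((a - phi) - (b - phi)) + b * ((d - phi) - (c - phi))) <=
     normc (a - phi) + normc (b - phi) + (normc (c - phi) + normc (d - phi)).
    apply: le_trans (le_normcD _ _) _; rewrite !normcM /b /d !f1 !mul1r.
    apply: lerD; apply: le_trans (le_normcD _ _) _; rewrite normcN //.
    by rewrite addrC.
  move: h' (normc_ge0 (d * ((a - phi) - (b - phi)) + b * ((d - phi) - (c - phi)))).
  move: (normc (d * _ + _)) (normc (a - _)) (normc (b - _)) (normc (c - _)) (normc (d - _)).
  move=> X y1 y2 y3 y4 hX X0.
  apply: (@le_trans _ _ ((y1 + y2 + (y3 + y4)) ^+ 2)).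
    by rewrite lerXn2r // nnegrE // (le_trans X0).
  have := sqr_ge0 (y1 - y2); have := sqr_ge0 (y1 - y3); have := sqr_ge0 (y1 - y4).
  have := sqr_ge0 (y2 - y3); have := sqr_ge0 (y2 - y4); have := sqr_ge0 (y3 - y4).
  rewrite !expr2; lra.
have shiftS (e : Om) : \sum_(w : Om) normc (f (w + e) - phi) ^+ 2 = \sum_(w : Om) normc (f w - phi) ^+ 2.
  by rewrite [RHS](reindex_inj (addIr e)).
have := @ler_sum _ _ (index_enum {: Om}) predT _ _ (fun w _ => bound w).
rewrite -mulr_sumr !big_split /= !shiftS.
have -> : \sum_(w : Om) normc (f (w + e1 s + e2 t) - phi) ^+ 2 = \sum_(w : Om) normc (f w - phi) ^+ 2.
  by rewrite -(shiftS (e1 s + e2 t)); apply: eq_bigr => w _; rewrite addrA.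
rewrite var => hh.
have gp : (0 : R) < g%:R by rewrite ltr0n ltnW.
have Op : (0 : R) < #|{: Om}|%:R by rewrite ltr0n card_Om_gt0.
have := shift_mean g1 separated_shiftable p (fun x => if x == 0 then normc D ^+ 2 else 0).
rewrite -(big_mkcond (fun x => x == 0)) big_pred1_eq => e.
rewrite -(ler_pM2l Op) -e mulrCA mulrCA.
have : g%:R * \sum_w (if pi p w == 0 then normc D ^+ 2 else 0) <= g%:R * (4 * (4 * (#|{: Om}|%:R * (1 - normc phi ^+ 2)))).
  rewrite ler_pM2l //; apply: le_trans hh _; lra.
by move/le_trans; apply; move: (#|_|%:R : R) (normc phi) => n y; lra.
Qed.

End Separated.

Section Annihilators.
Variables (g : nat) (g1 : (1 < g)%N) (I P : finType).
Variable pi : P -> {ffun I -> 'Z_g} -> 'Z_g.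
Local Notation Om := {ffun I -> 'Z_g}.
Hypothesis sep : separated pi.

Definition annihilators : {set {ffun P -> 'Z_g}} :=
  [set a : {ffun P -> 'Z_g} | [forall v : Om, \sum_p a p * pi p v == 0]].

Lemma annihilatorsP (a : {ffun P -> 'Z_g}) :
  reflect (forall v, \sum_p a p * pi p v = 0) (a \in annihilators).
Proof. by rewrite inE; apply: (iffP forallP) => h v; apply/eqP; apply: h. Qed.

Lemma sum_chi_annihilators (a : {ffun P -> 'Z_g}) :
  \sum_(v : Om) chi (\sum_p a p * pi p v) = if a \in annihilators then #|{: Om}|%:R else 0.
Proof.
case: annihilatorsP => [h|h].
  by under eq_bigr do rewrite h chi0; rewrite sumr_const.
have [v0 hv0] : exists v0 : Om, \sum_p a p * pi p v0 != 0.
  apply/existsP; apply: contra_notT h; rewrite negb_exists => /forallP h' v.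
  by have := h' v; rewrite negbK => /eqP.
set S := \sum_ _ _.
have e : S = chi (\sum_p a p * pi p v0) * S.
  rewrite /S mulr_sumr [LHS](reindex_inj (addIr v0)) /=.
  apply: eq_bigr => v _; rewrite -chiD //; congr (chi _).
  rewrite -big_split /=; apply: eq_bigr => p _.
  by rewrite (separatedD sep) mulrDr addrC.
have : (chi (\sum_p a p * pi p v0) - 1) * S = 0 by rewrite mulrBl mul1r -e subrr.
by move/eqP; rewrite mulf_eq0 subr_eq0 (negPf (chi_neq1 g1 hv0)) => /eqP.
Qed.

(** Dividing by [u p 0] makes closeness blind to scalar factors, in line with [char_term_scale]. *)
Definition near_char (d : R) (u : P -> 'Z_g -> C) (a : {ffun P -> 'Z_g}) : bool :=
  [forall p, forall x, normc (u p x / u p 0 / chi (a p * x) - 1) <= d].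

Lemma near_charP (d : R) (u : P -> 'Z_g -> C) (a : {ffun P -> 'Z_g}) :
  reflect (forall p x, normc (u p x / u p 0 / chi (a p * x) - 1) <= d) (near_char d u a).
Proof.
apply: (iffP forallP) => [h p x|h p]; first by move/forallP: (h p).
by apply/forallP.
Qed.

(** Were the mean too close to the circle, every [u p] would be near a scalar times some chi(a_p x).
    Either a is an annihilator, against the hypothesis, or v -> chi(sum a_p pi_p v) sums to 0 and
    the mean is at most |P| d, which is far from the circle. *)
Lemma char_mean_far (d : R) (u : P -> 'Z_g -> C) : 0 < d -> d <= 1 ->
  64 * (#|P|%:R * d) <= 1 -> (forall p x, normc (u p x) = 1) ->
  (forall a, a \in annihilators -> ~~ near_char d u a) ->
  (d / (9 * g%:R)) ^+ 2 <=
    16 * (g%:R * (1 - normc ((\sum_w \prod_p u p (pi p w)) / #|{: Om}|%:R) ^+ 2)).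
Proof.
move=> d0 d1 nd u1 far; set phi := _ / #|_|%:R; rewrite leNgt; apply/negP => lt.
have gR1 : (1 : R) <= g%:R by rewrite ler1n ltnW.
have gp : (0 : R) < g%:R by lra.
(* Chosen so that the loss 9 g k of [near_character] is exactly d. *)
set k := d / (9 * g%:R) in lt.
have k0 : 0 <= k by rewrite divr_ge0 ?mulr_ge0 ?ler0n // ltW.
have gk : 9 * (g%:R * k) = d by rewrite mulrA mulrC /k divfK // mulf_neq0 ?pnatr_eq0 // -lt0n ltnW.
have u0 q x : u q x != 0 by exact: normc_unit_neq0.
have hom p x y : normc (u p (x + y) / u p 0 - u p x / u p 0 * (u p y / u p 0)) <= k.
  have -> : u p (x + y) / u p 0 - u p x / u p 0 * (u p y / u p 0) =
     (u p x / u p 0 * (u p y / u p 0)) * (u p 0 * u p (x + y) / (u p x * u p y) - 1).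
    have hx := u0 p x; have hy := u0 p y; have h0 := u0 p 0.
    by move: (u p (x + y)) (u p x) (u p y) (u p 0) hx hy h0 => A B D E *; field; rewrite ?B; apply/and3P.
  rewrite !normcM !normcV !u1 !invr1 !mulr1 mul1r.
  rewrite -(@ler_pXn2r _ 2) ?nnegrE ?normc_ge0 //.
  by apply: le_trans (ltW lt); apply: (mixed_difference g1 sep u1).
have ap p : exists a : 'Z_g, forall x, normc (u p x / u p 0 / chi (a * x) - 1) <= d.
  have := @near_character g (fun x => u p x / u p 0) k g1.
  rewrite gk; apply; first by rewrite mulfV.
    by move=> x; rewrite normcM normcV !u1 invr1 mulr1.
  exact: hom.
have [a0 ha0] := fin_all_exists ap.
pose a := [ffun p => a0 p].
have near : near_char d u a by apply/near_charP => p x; rewrite ffunE.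
have [aH|aH] := boolP (a \in annihilators); first by move: (far a aH); rewrite near.
pose K := \prod_p u p 0.
have Op : (0 : R) < #|{: Om}|%:R by rewrite ltr0n card_Om_gt0.
have sumc (c : R) : \sum_(w : Om) c = #|{: Om}|%:R * c by rewrite sumr_const mulr_natl.
have hphi : normc phi <= #|P|%:R * d.
  rewrite /phi normcM normcV real_complex_nat normc_real (ger0_norm (ltW Op)) ler_pdivrMr // mulrC.
  have -> : \sum_w \prod_p u p (pi p w) =
     \sum_w (\prod_p u p (pi p w) - K * chi (\sum_p a p * pi p w)).
    by rewrite sumrB -mulr_sumr sum_chi_annihilators (negPf aH) mulr0 subr0.
  apply: le_trans (normc_sum_le _ _ _) _; rewrite -sumc; apply: ler_sum => w _.
  rewrite chi_sum // /K -big_split /=.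
  apply: le_trans (@normc_prod_sub _ (index_enum P) _ _ _ _) _ => [p|p|].
  - exact: u1.
  - by rewrite normcM normc_chi // u1 mulr1.
  have -> : #|P|%:R * d = \sum_(p : P) d by rewrite sumr_const mulr_natl.
  apply: ler_sum => p _; move/near_charP: near => /(_ p (pi p w)).
  have c0 := chi_neq0 (a p * pi p w).
  have -> : u p (pi p w) - u p 0 * chi (a p * pi p w) =
    (u p 0 * chi (a p * pi p w)) * (u p (pi p w) / u p 0 / chi (a p * pi p w) - 1).
    have h0 := u0 p 0; move: (chi _) c0 (u p 0) (u p _) h0 => c c0 x y x0.
    by field; apply/andP.
  by rewrite normcM (normcM (u p 0)) normc_chi // u1 !mul1r.
have phi2 : normc phi ^+ 2 <= 1 / 64.
  have := normc_ge0 phi; move: hphi nd; move: (normc phi) (#|P|%:R * d) => y z h1 h2 h3.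
  rewrite expr2; nra.
have k2 : k ^+ 2 <= 1.
  have : k <= d by rewrite /k ler_pdivrMr ?mulr_gt0 //; move: (g%:R : R) gR1 => n *; nra.
  by rewrite expr2; nra.
move: lt phi2 k2 gR1; clear; move: (normc phi ^+ 2) (k ^+ 2) (g%:R : R) => x y z *; nra.
Qed.

End Annihilators.

(** * Comparison of two systems with the same covariance *)

Section NearSum.
Variables (g : nat) (g1 : (1 < g)%N) (I P : finType).
Variable pi : P -> {ffun I -> 'Z_g} -> 'Z_g.
Local Notation Om := {ffun I -> 'Z_g}.
Hypothesis sep : separated pi.
Variable lam : nat.
Hypothesis lam_even : (\sum_(x : 'Z_g) x) *+ lam = 0.
(** This modulus exceeds N and lam, as [balanced_fourier] requires, and is a multiple of g, so that
    characters of Z_g occur among the frequencies. *)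
Local Notation m := (g * lam.+1)%N.
Local Notation N := (g * lam)%N.

(** Two such a and b differing at p give c nonzero with chi c within 2 d of 1. Then the sum of 1 -
    chi(j c) over j is at most 2 g^2 d, whereas orthogonality makes it g. *)
Lemma near_char_unique (d : R) (u : P -> 'Z_g -> C) a b : 4 * (g%:R * d) <= 1 ->
  near_char d u a -> near_char d u b -> a = b.
Proof.
move=> gd ha hb; apply/ffunP => p; apply/eqP; rewrite -subr_eq0; apply/negPn/negP => cn0.
have gp : (0 : R) < g%:R by rewrite ltr0n ltnW.
set c := a p - b p in cn0.
have hc : normc (chi c - 1) <= 2 * d.
  move/near_charP: ha => /(_ p 1); move/near_charP: hb => /(_ p 1); rewrite !mulr1.
  set U := u p 1 / u p 0.
  have key (z : 'Z_g) : normc (U / chi z - 1) = normc (U - chi z).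
    have z0 := chi_neq0 z; have -> : U - chi z = chi z * (U / chi z - 1).
      by rewrite mulrBr mulr1 mulrC divfK.
    by rewrite normcM normc_chi // mul1r.
  rewrite !key => hb ha.
  have -> : normc (chi c - 1) = normc (chi (a p) - chi (b p)).
    have -> : chi (a p) - chi (b p) = chi (b p) * (chi c - 1).
      by rewrite mulrBr mulr1 -chiD // /c [b p + _]addrC subrK.
    by rewrite normcM normc_chi // mul1r.
  have -> : chi (a p) - chi (b p) = (U - chi (b p)) + - (U - chi (a p)) by ring.
  by apply: le_trans (le_normcD _ _) _; rewrite normcN; lra.
have := sum_chi g1 c; rewrite (negPf cn0) => e.
have sumc (t : R) : \sum_(w : 'Z_g) t = g%:R * t by rewrite sumr_const card_Zg // mulr_natl.
have : normc (\sum_(j : 'Z_g) (1 - chi (j * c))) <= g%:R * (g%:R * (2 * d)).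
  apply: le_trans (normc_sum_le _ _ _) _; rewrite -sumc; apply: ler_sum => j _.
  rewrite normc_distC -{1}(natr_Zp j) mulr_natl chiMn //.
  apply: le_trans (normcX_sub1 _ (normc_chi _)) _.
  rewrite ler_pM ?ler0n ?normc_ge0 // ler_nat -[X in (_ <= X)%N](card_Zg g1) card_ord ltnW //.
rewrite sumrB e subr0 sumr_const card_Zg // real_complex_nat normc_real ger0_norm ?ler0n // => h.
have : g%:R * 1 <= g%:R * (g%:R * (2 * d)) by rewrite mulr1.
by rewrite ler_pM2l //; lra.
Qed.

Definition ffun_char (F : {ffun P * 'Z_g -> 'Z_m}) (p : P) (x : 'Z_g) : C := chi (F (p, x)).

Local Notation term F := (normalized_term pi lam N (ffun_char F)).

(** Multiplication by m / g = lam + 1 embeds Z_g into Z_m, so this multiplies the frequency at p by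
    chi(a_p x). *)
Definition twist (a : {ffun P -> 'Z_g}) (F : {ffun P * 'Z_g -> 'Z_m}) : {ffun P * 'Z_g -> 'Z_m} :=
  F + [ffun q => (lam.+1 * ((a q.1 * q.2)%R : 'Z_g))%:R].

Lemma modulus_gt1 : (1 < m)%N.
Proof. by rewrite mulnS; lia. Qed.

Lemma ffun_char_twist a F p x :
  ffun_char (twist a F) p x = ffun_char F p x * chi (a p * x).
Proof.
rewrite /ffun_char /twist !ffunE chiD ?modulus_gt1 //; congr (_ * _).
rewrite chi_nat ?modulus_gt1 // /chi /=; congr (cis _).
have gp : (g%:R : R) != 0 by rewrite pnatr_eq0 -lt0n ltnW.
have lp : (lam.+1%:R : R) != 0 by rewrite pnatr_eq0.
rewrite !natrM; move: (lam.+1%:R : R) (g%:R : R) (_%:R : R) lp gp => y z t y0 z0.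
by field; apply/andP.
Qed.

Lemma twist_inj a : injective (twist a).
Proof. exact: addIr. Qed.

Lemma near_char_twist d a F :
  near_char d (ffun_char (twist a F)) a = near_char d (ffun_char F) 0.
Proof.
have key (x y z : C) : z != 0 -> x * z / y / z = x / y.
  by move=> z0; rewrite [x * z / y]mulrAC mulfK.
apply: eq_forallb => p; apply: eq_forallb => x.
rewrite !ffun_char_twist !ffunE mul0r mulr0 !chi0 mulr1 divr1.
by rewrite key // chi_neq0.
Qed.

(** The numerator is unchanged because a annihilates; the denominator gains chi(a_p lam sum x),
    which is 1 by [lam_even]. *)
Lemma term_twist a F : a \in annihilators pi -> term (twist a F) = term F.
Proof.
move/annihilatorsP => aH; rewrite /normalized_term /char_term; congr (_ / _ / _).
  congr (_ ^+ _); apply: eq_bigr => w _.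
  under eq_bigr do rewrite ffun_char_twist.
  by rewrite big_split /= -(chi_sum g1 _ _ (fun p => a p * pi p w)) aH chi0 mulr1.
rewrite -!prodrXl; apply: eq_bigr => p _.
under eq_bigr do rewrite ffun_char_twist.
by rewrite big_split /= exprMn -(chi_sum g1 _ _ (fun x => a p * x)) -mulr_sumr -chiMn // -mulrnAr lam_even mulr0 chi0 mulr1.
Qed.

(** Here 2592 = 2 * 16 * 81: [char_mean_far] contributes 16 and 9^2, and passing from 1 - y^2 >= 2 r
    to y <= 1 - r contributes 2. *)
Lemma term_far (d : R) F : 0 < d -> d <= 1 -> 64 * (#|P|%:R * d) <= 1 ->
  (forall a, a \in annihilators pi -> ~~ near_char d (ffun_char F) a) ->
  normc (term F) <= (1 - (d / g%:R) ^+ 2 / (2592 * g%:R)) ^+ N.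
Proof.
move=> d0 d1 nd far.
have u1 p x : normc (ffun_char F p x) = 1 by exact: normc_cis.
have := char_mean_far g1 sep d0 d1 nd u1 far.
have -> : normc (term F) =
    normc ((\sum_w \prod_p ffun_char F p (pi p w)) / #|{: Om}|%:R) ^+ N.
  have hD : normc ((\prod_p \prod_x ffun_char F p x) ^+ lam) = 1.
    by rewrite normcX normc_prod big1 ?expr1n // => p _; rewrite normc_prod big1.
  rewrite /normalized_term /char_term -normcX exprMn exprVn [in LHS]normcM [in RHS]normcM.
  by rewrite normcM normcV hD invr1 mulr1.
have gR1 : (1 : R) <= g%:R by rewrite ler1n ltnW.
move: (normc_ge0 ((\sum_w \prod_p ffun_char F p (pi p w)) / #|{: Om}|%:R)).
move: (normc _) => y y0.
have -> : (d / (9 * g%:R)) ^+ 2 = (d / g%:R) ^+ 2 / 81.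
  by move: (g%:R : R) gR1 => n n1; field; lra.
set q := (d / g%:R) ^+ 2 => hq.
have q0 : 0 <= q by apply: sqr_ge0.
have q1 : q <= 1.
  by rewrite expr_le1 // ?divr_ge0 ?ler0n ?(ltW d0) // ler_pdivrMr; lra.
have gp : (0 : R) < g%:R by lra.
have h1 : 2 * (q / (2592 * g%:R)) <= 1 - y ^+ 2.
  rewrite mulrA ler_pdivrMr ?mulr_gt0 ?ltr0n ?(ltnW g1) //; clearbody q.
  by move: (g%:R : R) (y ^+ 2) gp hq => n y2 n0 hq; lra.
have h2 : q / (2592 * g%:R) <= 1.
  by rewrite ler_pdivrMr; lra.
rewrite lerXn2r ?nnegrE // ?subr_ge0 //.
rewrite -(@ler_pXn2r _ 2) ?nnegrE ?subr_ge0 //.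
move: (q / _) h1 h2 => r h1 h2; move: h1; rewrite !expr2; have := sqr_ge0 r; rewrite expr2; lra.
Qed.

Lemma near_sum_estimate (d : R) : 0 < d -> d <= 1 -> 64 * (#|P|%:R * d) <= 1 ->
  4 * (g%:R * d) <= 1 ->
  normc ((m ^ #|{: P * 'Z_g}|)%:R * (#|@balanced Om P 'Z_g pi lam N|%:R / #|{: Om}|%:R ^+ N) -
    #|annihilators pi|%:R * \sum_(F | near_char d (ffun_char F) 0) term F) <=
  (m ^ #|{: P * 'Z_g}|)%:R * (1 - (d / g%:R) ^+ 2 / (2592 * g%:R)) ^+ N.
Proof.
move=> d0 d1 nd gd; set H := annihilators pi; set rho := (_ ^+ N in X in _ <= X).
have -> : (m ^ #|{: P * 'Z_g}|)%:R * (#|@balanced Om P 'Z_g pi lam N|%:R / #|{: Om}|%:R ^+ N) =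
   \sum_F term F.
  rewrite mulrA (@balanced_fourier _ _ _ _ _ N m) ?modulus_gt1 //; last 2 first.
  - by rewrite mulnS; lia.
  - by rewrite mulnS; nia.
  by rewrite mulr_suml.
(* The windows around the annihilators are disjoint by [near_char_unique], and twisting carries the
   trivial window onto each of them without changing the terms. *)
have -> : #|H|%:R * \sum_(F | near_char d (ffun_char F) 0) term F =
   \sum_(F | [exists a in H, near_char d (ffun_char F) a]) term F.
  transitivity (\sum_(a in H) \sum_(F | near_char d (ffun_char F) a) term F).
    rewrite mulr_natl -sumr_const; apply: eq_bigr => a aH.
    rewrite [RHS](reindex_inj (@twist_inj a)) /=.
    by apply: eq_big => [F|F _]; rewrite ?near_char_twist ?term_twist.
  rewrite (exchange_big_dep (fun F => [exists a in H, near_char d (ffun_char F) a])) /=.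
    apply: eq_bigr => F /existsP[a /andP[aH ha]].
    rewrite (bigD1 a) /=; last by rewrite aH.
    rewrite big1 ?addr0 // => b /andP[/andP[_ hb]].
    by rewrite (near_char_unique gd ha hb) eqxx.
  by move=> a F aH ha; apply/existsP; exists a; rewrite aH.
rewrite (bigID (fun F => [exists a in H, near_char d (ffun_char F) a])) /= addrC addrK.
apply: le_trans (normc_sum_le _ _ _) _.
have rho0 : 0 <= rho.
  have gp : (1 : R) <= g%:R by rewrite ler1n ltnW.
  rewrite exprn_ge0 // subr_ge0 ler_pdivrMr ?mulr_gt0 ?ltr0n ?(ltnW g1) // mul1r.
  have : (d / g%:R) ^+ 2 <= 1.
    by rewrite expr_le1 // ?divr_ge0 ?ler0n ?(ltW d0) // ler_pdivrMr; lra.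
  by lra.
have -> : (m ^ #|{: P * 'Z_g}|)%:R * rho = \sum_(F : {ffun P * 'Z_g -> 'Z_m}) rho.
  by rewrite sumr_const card_ffun (card_Zg modulus_gt1) mulr_natl.
rewrite [leLHS]big_mkcond /=; apply: ler_sum => F _; case: ifP => // nF.
apply: term_far => // a aH; apply: contra nF => ha.
by apply/existsP; exists a; rewrite aH.
Qed.

End NearSum.

Definition balanced_ratio (g : nat) (I P : finType) (pi : P -> {ffun I -> 'Z_g} -> 'Z_g)
    (lam : nat) : R :=
  #|@balanced {ffun I -> 'Z_g} P 'Z_g pi lam (g * lam)|%:R / #|{: {ffun I -> 'Z_g}}|%:R ^+ (g * lam).

(** S is the unknown main sum shared by both systems. The second estimate bounds S through a2, which
    eliminates it from the first. *)
Lemma sandwich_compare (W a1 a2 h S r e : R) : 0 < W -> 1 <= h -> 0 <= S -> 0 <= a2 ->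
  0 <= W * r -> 0 <= e -> e <= 1 / 2 ->
  `|W * a1 - h * S| <= W * r + h * (e * S) -> `|W * a2 - S| <= W * r + e * S ->
  `|a1 - h * a2| <= h * (4 * r + 4 * e * a2).
Proof.
move=> W0 h1 S0 a20 r0 e0 e2 b1 b2.
have h0 : 0 <= h by lra.
rewrite -(ler_pM2l W0) -{1}(ger0_norm (ltW W0)) -normrM.
have -> : W * (a1 - h * a2) = (W * a1 - h * S) - h * (W * a2 - S) by ring.
apply: le_trans (ler_normB _ _) _; rewrite normrM (ger0_norm h0).
have Sb : S <= 2 * (W * a2 + W * r).
  have := ler_norm (- (W * a2 - S)); rewrite normrN => b3.
  have b4 : S - W * a2 <= W * r + e * S by apply: le_trans b2; rewrite -opprB.
  have : e * S <= 1 / 2 * S by rewrite ler_wpM2r.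
  lra.
have Wa0 : 0 <= W * a2 by rewrite mulr_ge0 // ltW.
have -> : W * (h * (4 * r + 4 * e * a2)) = h * (4 * (W * r) + 4 * (e * (W * a2))) by ring.
move: b1 b2; move: `|W * a1 - _| `|W * a2 - _| => x y hx hy.
move: (W * r) (W * a2) r0 hx hy Sb Wa0 => q t q0 hx hy Sb t0.
have z1 : h * y <= h * (q + e * S) by rewrite ler_wpM2l.
have z2 : e * S <= 2 * (e * t) + q.
  have : e * S <= e * (2 * (t + q)) by rewrite ler_wpM2l.
  have : e * q <= 1 / 2 * q by rewrite ler_wpM2r.
  lra.
have z3 : q <= h * q by rewrite ler_peMl.
have : h * (e * S) <= h * (2 * (e * t) + q) by rewrite ler_wpM2l.
lra.
Qed.

Lemma balanced_ratio_compare (g lam : nat) (I1 I2 P : finType)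
    (pi1 : P -> {ffun I1 -> 'Z_g} -> 'Z_g) (pi2 : P -> {ffun I2 -> 'Z_g} -> 'Z_g) (d e : R) :
  (1 < g)%N -> separated pi1 -> separated pi2 -> (\sum_(x : 'Z_g) x) *+ lam = 0 ->
  #|annihilators pi2| = 1%N ->
  0 < d -> d <= 1 -> 64 * (#|P|%:R * d) <= 1 -> 4 * (g%:R * d) <= 1 ->
  (1 + 2 * (16 * (#|P|%:R * d)) ^+ 3) ^+ (g * lam) <= 1 + e -> 0 <= e -> e <= 1 / 2 ->
  `|balanced_ratio pi1 lam - #|annihilators pi1|%:R * balanced_ratio pi2 lam| <=
  #|annihilators pi1|%:R *
    (4 * (1 - (d / g%:R) ^+ 2 / (2592 * g%:R)) ^+ (g * lam) + 4 * e * balanced_ratio pi2 lam).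
Proof.
move=> g1 sep1 sep2 lam0 H2 d0 d1 nd gd he e0 e2.
have := near_sum_estimate g1 sep1 lam0 d0 d1 nd gd.
have := near_sum_estimate g1 sep2 lam0 d0 d1 nd gd.
have a20 : 0 <= balanced_ratio pi2 lam by rewrite divr_ge0 ?exprn_ge0 ?ler0n.
have h1 : 1 <= (#|annihilators pi1|%:R : R).
  rewrite ler1n; apply/card_gt0P; exists 0; apply/annihilatorsP => v.
  by rewrite big1 // => p _; rewrite ffunE mul0r.
rewrite H2 mul1r.
have ratioC (I : finType) (pi : P -> {ffun I -> 'Z_g} -> 'Z_g) :
    #|@balanced _ _ _ pi lam (g * lam)|%:R / #|{: {ffun I -> 'Z_g}}|%:R ^+ (g * lam) =
    ((balanced_ratio pi lam)%:C)%C :> C.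
  by rewrite /balanced_ratio rmorphM /= fmorphV /= rmorphXn /= !rmorph_nat.
rewrite !ratioC; set W := (_ ^ _)%N; set r := _ ^+ _.
set Z1 := \sum_(F | _) normalized_term pi1 _ _ _; set Z2 := \sum_(F | _) normalized_term pi2 _ _ _.
have W0 : (0 : R) < W%:R by rewrite ltr0n expn_gt0 (ltnW (modulus_gt1 g1 lam)).
(* One s per near frequency, valid for both systems; frequencies outside the window get the dummy
   value 0. *)
have pt (F : {ffun P * 'Z_g -> 'Z_(g * lam.+1)}) : exists2 s : R, 0 <= s &
    near_char d (ffun_char F) 0 ->
      normc (normalized_term pi1 lam (g * lam) (ffun_char F) - (s%:C)%C) <= e * s /\
      normc (normalized_term pi2 lam (g * lam) (ffun_char F) - (s%:C)%C) <= e * s.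
  have [nF|nF] := boolP (near_char d (ffun_char F) 0); last by exists 0.
  have u1 p x : normc (ffun_char F p x) = 1 by exact: normc_cis.
  have ud p x : normc (ffun_char F p x / ffun_char F p 0 - 1) <= d.
    by move/near_charP: nF => /(_ p x); rewrite ffunE mul0r chi0 divr1.
  have [s s0 hs] := normalized_term_near g1 u1 ud nd he.
  by exists s => // _; split; apply: hs; rewrite ?card_Om_gt0 //; apply: separated_shiftable.
have [s s0 hs] := fin_all_exists2 pt.
pose S := \sum_(F | near_char d (ffun_char F) 0) s F.
have SC : ((S%:C)%C : C) = \sum_(F | near_char d (ffun_char F) 0) ((s F)%:C)%C by rewrite rmorph_sum.
have S0 : 0 <= S by apply: sumr_ge0.
have hZ1 : normc (Z1 - (S%:C)%C) <= e * S.
  rewrite SC -sumrB; apply: le_trans (normc_sum_le _ _ _) _; rewrite mulr_sumr.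
  by apply: ler_sum => F nF; case: (hs F nF).
have hZ2 : normc (Z2 - (S%:C)%C) <= e * S.
  rewrite SC -sumrB; apply: le_trans (normc_sum_le _ _ _) _; rewrite mulr_sumr.
  by apply: ler_sum => F nF; case: (hs F nF).
move=> k2 k1.
set h : R := #|annihilators pi1|%:R in h1 *.
have hC : (#|annihilators pi1|%:R : C) = (h%:C)%C by rewrite real_complex_nat.
set a1 := balanced_ratio pi1 lam in k1 *; set a2 := balanced_ratio pi2 lam in k2 a20 *.
rewrite hC !(real_complex_nat W) in k1 k2.
clearbody a1 a2.
have b2 : `|W%:R * a2 - S| <= W%:R * r + e * S.
  rewrite -normc_real rmorphB rmorphM.
  rewrite -(subrKA Z2).
  by apply: le_trans (le_normcD _ _) _; apply: lerD.
have b1 : `|W%:R * a1 - h * S| <= W%:R * r + h * (e * S).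
  rewrite -normc_real rmorphB !rmorphM.
  rewrite -(subrKA ((h%:C)%C * Z1)) -mulrBr.
  apply: le_trans (le_normcD _ _) _; apply: lerD => //.
  by rewrite normcM normc_real ger0_norm ?ler0n // ler_wpM2l // ler0n.
apply: (sandwich_compare W0 h1 S0 a20 _ e0 e2 b1 b2).
by apply: le_trans k2; apply: normc_ge0.
Qed.

(** * Difference matrices and the independent model *)

(** Double counting of the sum of chi(sum a_p pi_p v) over all a and v: summing over v first selects
    annihilators, summing over a first selects the common kernel. *)
Lemma card_annihilators (g : nat) (I P : finType) (pi : P -> {ffun I -> 'Z_g} -> 'Z_g) :
  (1 < g)%N -> separated pi ->
  (#|annihilators pi| * #|{: {ffun I -> 'Z_g}}|)%N =
  (g ^ #|P| * #|[set v | [forall p, pi p v == 0%R]]|)%N.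
Proof.
move=> g1 sep; apply/eqP; rewrite -(@eqr_nat C) !natrM.
have -> : #|annihilators pi|%:R * #|{: {ffun I -> 'Z_g}}|%:R =
    \sum_(a : {ffun P -> 'Z_g}) \sum_(v : {ffun I -> 'Z_g}) chi (\sum_p a p * pi p v) :> C.
  under eq_bigr do rewrite sum_chi_annihilators //.
  by rewrite -big_mkcond sumr_const mulr_natl.
rewrite exchange_big /=.
have E (v : {ffun I -> 'Z_g}) : \sum_(a : {ffun P -> 'Z_g}) chi (\sum_p a p * pi p v) =
    if v \in [set v | [forall p, pi p v == 0%R]] then (g ^ #|P|)%:R else 0.
  under eq_bigr do rewrite chi_sum //.
  rewrite -(bigA_distr_bigA (fun p b => chi (b * pi p v))) /=.
  under eq_bigr do rewrite sum_chi //.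
  rewrite inE; case: ifP => [/forallP h|/negbT/forallPn[p hp]].
    by rewrite natrX -prodr_const; apply: eq_bigr => p _; rewrite h.
  by rewrite (bigD1 p) //= (negPf hp) mul0r.
by rewrite (eq_bigr _ (fun v _ => E v)) -big_mkcond sumr_const mulr_natr eqxx.
Qed.

(** The sum is C(g,2): g divides it when g is odd, and divides C(g,2) lam when lam is even. *)
Lemma sum_Zg_mulrn (g lam : nat) : (1 < g)%N -> odd g || ~~ odd lam ->
  (\sum_(x : 'Z_g) x) *+ lam = 0.
Proof.
move=> g1 h.
have -> : \sum_(x : 'Z_g) x = ('C(g, 2))%:R.
  have -> : 'C(g, 2) = (\sum_(x : 'Z_g) (x : nat))%N.
    by rewrite -(big_mkord xpredT id) Zp_cast // bin2_sum.
  by rewrite natr_sum; apply: eq_bigr => x _; rewrite natr_Zp.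
rewrite -mulrnA; suff /dvdnP[c ->] : (g %| 'C(g, 2) * lam)%N by rewrite natrM pchar_Zp // mulr0.
case/orP: h => [og|el]; first by rewrite bin2odd // -mulnA dvdn_mulr.
have -> : lam = (2 * lam./2)%N by rewrite mul2n even_halfK.
rewrite mulnA [('C(g, 2) * 2)%N]mulnC mul2n bin2 even_halfK ?oddM; last first.
  by case: g {g1} => //= g; case: (odd g).
by rewrite -mulnA dvdn_mulr.
Qed.

(** * Difference matrices as balanced walks *)

Section Pairs.
Variables (g : nat) (g1 : (1 < g)%N) (k : nat).

Definition upair : finType := {q : 'I_k * 'I_k | (q.1 < q.2)%N}.

Definition pair_diff (p : upair) (v : {ffun 'I_k -> 'Z_g}) : 'Z_g :=
  v (val p).1 - v (val p).2.

Lemma card_upair : #|{: upair}| = 'C(k, 2).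
Proof.
rewrite card_sig -sum1_card -(pair_big_dep predT (fun i j : 'I_k => (i < j)%N) (fun _ _ => 1%N)) /=.
rewrite (exchange_big_dep predT) //= -bin2_sum big_mkord; apply: eq_bigr => j _.
rewrite sum1_card -[RHS]card_ord.
rewrite -(card_image (f := widen_ord (ltnW (ltn_ord j))) _); last first.
  by move=> x y /(congr1 val) /= h; apply: val_inj.
apply: eq_card => i; rewrite unfold_in; apply/idP/imageP => [ij|[x _ ->]]; last exact: (ltn_ord x).
by exists (Ordinal ij) => //; apply: val_inj.
Qed.

(** For p = (i, j) the directions move coordinate i by s and coordinate j by -s. A pair meeting both
    i and j is p itself, so any other pair is killed by one of them. *)
Lemma separated_pair_diff : separated pair_diff.
Proof.
split=> [p v w|p]; first by rewrite /pair_diff !ffunE opprD addrACA.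
case: p => [[i j] /= ij].
have nij : (i == j) = false by apply/negbTE; rewrite -val_eqE /= ltn_eqF.
exists (fun s => [ffun l => if l == i then s else 0]).
exists (fun s => [ffun l => if l == j then - s else 0]).
split=> [s|s|q qp]; rewrite /pair_diff /= ?ffunE /= ?eqxx ?nij ?[j == i]eq_sym ?nij ?subr0 ?opprK ?add0r //.
case: q qp => [[a b] /= ab] qp.
have [ia|ia] := boolP ((a == i) || (b == i)); last first.
  by left=> s; rewrite !ffunE /=; move: ia; rewrite negb_or => /andP[/negPf-> /negPf->]; rewrite subr0.
right=> s; rewrite !ffunE /=.
have [ja|] := boolP ((a == j) || (b == j)); last first.
  by rewrite negb_or => /andP[/negPf-> /negPf->]; rewrite subr0.
exfalso; move/negP: qp; apply; apply/eqP/val_inj => /=.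
case/orP: ia => /eqP e1; case/orP: ja => /eqP e2; subst => //.
- by move: nij; rewrite eqxx.
- by move: ab ij => /=; lia.
- by move: nij; rewrite eqxx.
Qed.

(** The common kernel of all differences consists of the g constant vectors. The factor g^k stays on
    the left to avoid subtraction in the exponent. *)
Lemma card_pair_annihilators : (0 < k)%N ->
  (#|annihilators pair_diff| * g ^ k = g ^ 'C(k, 2) * g)%N.
Proof.
move=> k0; have := card_annihilators g1 separated_pair_diff.
rewrite card_ffun card_Zg // card_ord card_upair => ->; congr (_ * _)%N.
pose c (x : 'Z_g) : {ffun 'I_k -> 'Z_g} := [ffun=> x].
rewrite -[RHS](card_Zg g1) -(card_imset (f := c)); last first.
  by move=> x y /ffunP/(_ (Ordinal k0)); rewrite !ffunE.
apply: eq_card => v; rewrite inE; apply/forallP/imsetP => [h|[x _ ->] p]; last first.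
  by rewrite /pair_diff !ffunE subrr.
exists (v (Ordinal k0)) => //; apply/ffunP => i; rewrite ffunE.
have [->//|i0] := eqVneq i (Ordinal k0).
have hi : (Ordinal k0 < i)%N by rewrite /= lt0n; apply: contra i0 => /eqP e; apply/eqP/val_inj.
have := h (exist (fun q : 'I_k * 'I_k => (q.1 < q.2)%N) (Ordinal k0, i) hi).
by rewrite /pair_diff /= subr_eq0 => /eqP.
Qed.

Lemma card_balanced_pair_diff lam :
  #|@balanced {ffun 'I_k -> 'Z_g} upair 'Z_g pair_diff lam (g * lam)| =
  num_diff_matrices g k lam.
Proof.
rewrite /num_diff_matrices.
pose M (w : {ffun 'I_(g * lam) -> {ffun 'I_k -> 'Z_g}}) : 'M['Z_g]_(k, g * lam) := \matrix_(i, l) w l i.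
have Minj : injective M.
  move=> w w' /matrixP h; apply/ffunP => l; apply/ffunP => i.
  by have := h i l; rewrite !mxE.
rewrite -(card_image Minj); apply: eq_card => D.
apply/imageP/idP => [[w hw ->]|hD].
  apply/forallP => i; apply/forallP => j; apply/implyP => ij; apply/forallP => x.
  move/forallP: hw => /(_ (exist (fun q : 'I_k * 'I_k => (q.1 < q.2)%N) (i, j) ij))/forallP/(_ x)/eqP hc.
  by apply/eqP; rewrite -[RHS]hc; apply: eq_card => l; rewrite !inE /M !mxE.
exists [ffun l => [ffun i => D i l]]; last by apply/matrixP => i l; rewrite !mxE !ffunE.
apply/forallP => -[[i j] ij]; apply/forallP => x.
move/forallP: hD => /(_ i)/forallP/(_ j)/implyP/(_ ij)/forallP/(_ x)/eqP hc.
by apply/eqP; rewrite -[RHS]hc; apply: eq_card => l; rewrite !inE /pair_diff /= !ffunE.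
Qed.

End Pairs.

(** * The model with mutually independent projections *)

Section Coordinates.
Variables (g : nat) (g1 : (1 < g)%N) (P : finType).

Definition coordinate (p : P) (v : {ffun P -> 'Z_g}) : 'Z_g := v p.

Lemma separated_coordinate : separated coordinate.
Proof.
split=> [p v w|p]; first by rewrite /coordinate !ffunE.
exists (fun s => [ffun q => if q == p then s else 0]).
exists (fun s => [ffun q => if q == p then s else 0]).
split=> [s|s|q qp]; rewrite /coordinate ?ffunE ?eqxx //.
by left=> s; rewrite ffunE (negPf qp).
Qed.

Lemma card_coordinate_annihilators : #|annihilators coordinate| = 1%N.
Proof.
have := card_annihilators g1 separated_coordinate.
rewrite card_ffun card_Zg // [#|[set v | _]|](_ : _ = 1%N); last first.
  apply/eqP/cards1P; exists 0; apply/setP => v; rewrite !inE.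
  apply/forallP/eqP => [h|-> p]; last by rewrite /coordinate ffunE.
  by apply/ffunP => p; rewrite ffunE; apply/eqP; exact: h.
by move/eqP; rewrite mulnC eqn_pmul2l ?expn_gt0 ?(ltnW g1) // => /eqP.
Qed.

Definition equidistributed lam (u : {ffun 'I_(g * lam) -> 'Z_g}) : bool :=
  [forall x, #|[pred l | u l == x]| == lam].

Lemma card_balanced_coordinate lam :
  #|@balanced {ffun P -> 'Z_g} P 'Z_g coordinate lam (g * lam)| =
  (#|@equidistributed lam| ^ #|P|)%N.
Proof.
pose sw (f : {ffun P -> {ffun 'I_(g * lam) -> 'Z_g}}) : {ffun 'I_(g * lam) -> {ffun P -> 'Z_g}} :=
  [ffun l => [ffun p => f p l]].
have swi : injective sw.
  move=> f f' /ffunP h; apply/ffunP => p; apply/ffunP => l.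
  by have /ffunP/(_ p) := h l; rewrite !ffunE.
rewrite -card_ffun_on -(card_image swi); apply: eq_card => w.
apply/idP/imageP => [hw|[f /ffun_onP hf ->]].
  exists [ffun p => [ffun l => w l p]]; last by apply/ffunP => l; apply/ffunP => p; rewrite !ffunE.
  apply/ffun_onP => p; rewrite ffunE; apply/forallP => x.
  move/forallP: hw => /(_ p)/forallP/(_ x)/eqP hc.
  by apply/eqP; rewrite -[RHS]hc; apply: eq_card => l; rewrite !inE /coordinate ffunE.
apply/forallP => p; apply/forallP => x.
move: (hf p) => /forallP/(_ x)/eqP hc.
by apply/eqP; rewrite -[RHS]hc; apply: eq_card => l; rewrite !inE /coordinate !ffunE.
Qed.

End Coordinates.

(** * Multinomial counting *)

Section Fibers.
Local Open Scope nat_scope.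

(** Induction on the first letter y: words starting with y contribute c(y) n!, and the c(y) add up
    to n + 1. *)
Lemma card_ffun_fibers (T : finType) n (c : T -> nat) : \sum_x c x = n ->
  #|[pred u : {ffun 'I_n -> T} | [forall x, \sum_(l < n) (u l == x) == c x]]| * \prod_x (c x)`! = n`!.
Proof.
elim: n c => [|n IH] c hc.
  have c0 x : c x = 0 by apply/eqP; move/eqP: hc; rewrite sum_nat_eq0 => /forallP/(_ x).
  rewrite (eq_card (B := predT)) => [|u]; last first.
    by rewrite !inE; apply/forallP => x; rewrite big_ord0 c0.
  by rewrite card_ffun card_ord expn0 big1 // => x _; rewrite c0.
set A := [pred u : {ffun 'I_n.+1 -> T} | _].
pose ext (y : T) (u : {ffun 'I_n -> T}) : {ffun 'I_n.+1 -> T} :=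
  [ffun l => if unlift ord0 l is Some l' then u l' else y].
have ext_inj y : injective (ext y).
  move=> u u' /ffunP h; apply/ffunP => l; have := h (lift ord0 l).
  by rewrite !ffunE liftK.
pose c' y x := c x - (x == y).
have key y : #|[pred u in A | u ord0 == y]| * \prod_x (c x)`! = c y * n`!.
  (* Truncated subtraction would spoil [c' y] here, but no admissible word starts with y and both
     sides are 0. *)
  have [cy|cy] := posnP (c y).
    rewrite cy mul0n; apply/eqP; rewrite muln_eq0; apply/orP; left.
    apply/eqP/eq_card0 => u; rewrite !inE; apply/negP => /andP[/forallP/(_ y)].
    by rewrite cy big_ord_recl => /eqP + /eqP uy; rewrite uy eqxx.
  have sc' : \sum_x c' y x = n.
    move: hc; rewrite (bigD1 y) //= => hc.
    rewrite (bigD1 y) //= /c' eqxx (eq_bigr c); first by lia.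
    by move=> x /negPf ->; rewrite subn0.
  have -> : \prod_x (c x)`! = c y * \prod_x (c' y x)`!.
    rewrite (bigD1 y) //= [in RHS](bigD1 y) //= /c' eqxx subn1 mulnA.
    rewrite -[X in X`!](prednK cy) factS prednK //; congr (_ * _).
    by apply: eq_bigr => x /negPf ->; rewrite subn0.
  rewrite mulnCA -(IH _ sc'); congr (_ * (_ * _)).
  rewrite -(card_image (ext_inj y)); apply: eq_card => u.
  have cE v x : (\sum_(l < n.+1) (v l == x) == c x) && (v ord0 == y) =
      (\sum_(l < n) (v (lift ord0 l) == x) == c' y x) && (v ord0 == y).
    case: (v ord0 =P y) => [vy|_]; last by rewrite !andbF.
    rewrite !andbT big_ord_recl vy /c' [y == x]eq_sym; case: (x =P y) => [xy|_]; last by rewrite subn0.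
    by rewrite -xy in cy *; lia.
  apply/andP/imageP => [[/forallP hu /eqP uy]|[v hv ->]].
    have {}uy : u ord0 = y := uy.
    exists [ffun l => u (lift ord0 l)].
      rewrite inE; apply/forallP => x; have := cE u x; rewrite (hu x) uy eqxx !andbT => /esym hh.
      by rewrite (eq_bigr (fun l => nat_of_bool (u (lift ord0 l) == x))) // => l _; rewrite ffunE.
    apply/ffunP => l; rewrite ffunE; case: unliftP => [l' ->|->]; first by rewrite ffunE.
    exact: uy.
  have e0 : ext y v ord0 == y by rewrite ffunE unlift_none.
  split=> //; apply/forallP => x; have := cE (ext y v) x; rewrite e0 !andbT => ->.
  under eq_bigr do rewrite ffunE liftK.
  by move: hv; rewrite inE => /forallP/(_ x).
have -> : #|A| = \sum_y #|[pred u in A | u ord0 == y]|.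
  rewrite -sum1_card (partition_big (fun u : {ffun 'I_n.+1 -> T} => u ord0) predT) //=.
  by apply: eq_bigr => y _; rewrite sum1_card.
rewrite big_distrl /= (eq_bigr _ (fun y _ => key y)) -big_distrl /= hc.
by rewrite factS.
Qed.

Lemma card_equidistributed (g lam : nat) : 1 < g ->
  #|@equidistributed g lam| * lam`! ^ g = (g * lam)`!.
Proof.
move=> g1; rewrite -(@card_ffun_fibers 'Z_g (g * lam) (fun=> lam)); last first.
  by rewrite sum_nat_const card_Zg.
rewrite prod_nat_const card_Zg //; congr (_ * _); apply: eq_card => u.
rewrite inE; apply: eq_forallb => x; congr (_ == _).
by rewrite -sum1_card big_mkcond /=; apply: eq_bigr => l _; rewrite inE; case: eqP.
Qed.

End Fibers.

Lemma choose2 (k : nat) : Nat.mul 2 (Defs.choose k 2) = Nat.mul k (Nat.sub k 1).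
Proof.
rewrite /Defs.choose multE minusE subn1.
by rewrite mul2n bin2 even_halfK //; case: k => // k; rewrite oddM /=; case: (odd k).
Qed.

(** The non-asymptotic outcome in the vocabulary of the standard reals. Here p is the probability
    that a uniform word of length N over Z_g is equidistributed, and h is the number of
    annihilators. *)
Theorem num_diff_matrices_estimate (g k lam : nat) (d e : R) :
  let n := Defs.choose k 2 in
  let N := (g * lam)%coq_nat in
  let p := (INR (Factorial.fact N) / (INR (Factorial.fact lam) ^ g * INR g ^ N))%coqR in
  let h := (INR g ^ n * INR g / INR g ^ k)%coqR in
  (2 <= g)%coq_nat -> (1 <= k)%coq_nat -> (Nat.Even g -> Nat.Even lam) ->
  (0 < d)%coqR -> (d <= 1)%coqR -> (64 * (INR n * d) <= 1)%coqR -> (4 * (INR g * d) <= 1)%coqR ->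
  ((1 + 2 * (16 * (INR n * d)) ^ 3) ^ N <= 1 + e)%coqR -> (0 <= e)%coqR -> (e <= 1 / 2)%coqR ->
  (Rabs (INR (num_diff_matrices g k lam) / INR g ^ (k * N)%coq_nat - h * p ^ n)%coqR <=
   h * (4 * (1 - (d / INR g) ^ 2 / (2592 * INR g)) ^ N + 4 * e * p ^ n))%coqR.
Proof.
move=> n N p h /ssrnat.leP g1 /ssrnat.leP k1 par /RltP d0 /RleP d1 /RleP nd /RleP gd /RleP he /RleP e0 /RleP e2.
apply/RleP.
have par' : odd g || ~~ odd lam.
  case: (boolP (odd g)) => //= og.
  have /par[j ->] : Nat.Even g.
    by exists (g./2); rewrite multE mul2n even_halfK.
  by rewrite multE mul2n odd_double.
have lam0 := sum_Zg_mulrn g1 par'.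
have nE : #|{: upair k}| = n by rewrite card_upair.
have := @balanced_ratio_compare g lam 'I_k (upair k) (upair k) (@pair_diff g k)
  (@coordinate g (upair k)) d e g1 (@separated_pair_diff g g1 k)
  (@separated_coordinate g (upair k)) lam0 (card_coordinate_annihilators g1 _) d0 d1.
rewrite nE.
have gp : (0 : R) < g%:R by rewrite ltr0n ltnW.
have gn : (g%:R : R) != 0 by rewrite gt_eqF.
have hE : #|annihilators (@pair_diff g k)|%:R = h :> R.
  rewrite /h !RealsE; apply: (mulIf (x := g%:R ^+ k)); first by rewrite expf_neq0.
  rewrite divfK ?expf_neq0 //.
  have /(congr1 (fun x : nat => x%:R : R)) := card_pair_annihilators g1 (k := k) k1.
  by rewrite !natrM !natrX.
have rE : balanced_ratio (@pair_diff g k) lam =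
    INR (num_diff_matrices g k lam) / INR g ^+ (k * N).
  rewrite /balanced_ratio card_balanced_pair_diff card_ffun (card_Zg g1) card_ord !RealsE.
  by rewrite natrX -exprM.
have mE : balanced_ratio (@coordinate g (upair k)) lam = p ^+ n.
  rewrite /balanced_ratio card_balanced_coordinate card_ffun (card_Zg g1) nE.
  rewrite !natrX exprAC -expr_div_n; congr (_ ^+ _).
  rewrite /p !RealsE -(card_equidistributed lam g1) natrM natrX.
  have l0 : ((lam`!)%:R : R) ^+ g != 0 by rewrite expf_neq0 // pnatr_eq0 -lt0n fact_gt0.
  by rewrite invfM mulrA mulfK.
rewrite hE rE mE => H.
move: nd gd he e2; rewrite !RealsE => nd gd he e2.
rewrite !RealsE in H *.
exact: H.
Qed.

End Fourier.

Import Stirling Fourier.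

(** * Asymptotics *)

Lemma exp_pow (y : R) (m : nat) : exp y ^ m = exp (INR m * y).
Proof.
rewrite <- (ln_exp y) at 2. rewrite <- ln_pow by apply exp_pos.
rewrite exp_ln; [reflexivity|apply pow_lt, exp_pos].
Qed.

Lemma Rabs_le_inv (x y : R) : Rabs x <= y -> - y <= x <= y.
Proof.
intros h; pose proof (Rle_abs x); pose proof (Rle_abs (- x)) as h'.
rewrite Rabs_Ropp in h'; lra.
Qed.

Lemma exp_mono (x y : R) : x <= y -> exp x <= exp y.
Proof. intros [h|h]; [left; apply exp_increasing, h|rewrite h; lra]. Qed.

Lemma sqrt_exp (y : R) : sqrt (exp y) = exp (y / 2).
Proof.
replace (exp y) with (exp (y / 2) * exp (y / 2)) by (rewrite <- exp_plus; f_equal; field).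
apply sqrt_square; left; apply exp_pos.
Qed.

(** The terms of order N ln N and N cancel, leaving one Stirling error at g lam and g of them at
    lam. *)
Lemma ln_equidistribution (g lam : nat) : (1 <= g)%nat -> (1 <= lam)%nat ->
  let p := INR (fact (g * lam)) / (INR (fact lam) ^ g * INR g ^ (g * lam)) in
  0 < p /\
  Rabs (ln p - (ln (INR g) / 2 - (INR g - 1) / 2 * ln (2 * PI * INR lam))) <= INR g / INR lam.
Proof.
intros hg hl p.
assert (g1 : 1 <= INR g) by (apply (le_INR 1); lia).
assert (l1 : 1 <= INR lam) by (apply (le_INR 1); lia).
assert (f1 : 0 < INR (fact lam)) by (apply lt_0_INR, lt_O_fact).
assert (f2 : 0 < INR (fact (g * lam))) by (apply lt_0_INR, lt_O_fact).
assert (q1 : 0 < INR (fact lam) ^ g) by (apply pow_lt; lra).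
assert (q2 : 0 < INR g ^ (g * lam)) by (apply pow_lt; lra).
assert (q3 : 0 < INR (fact lam) ^ g * INR g ^ (g * lam)) by (apply Rmult_lt_0_compat; lra).
assert (p0 : 0 < p) by (apply Rdiv_lt_0_compat; lra).
split; [exact p0|].
pose proof PI_RGT_0 as hpi.
pose proof (stirling_bounds (g * lam) ltac:(nia)) as s1.
pose proof (stirling_bounds lam hl) as s2.
assert (e : ln p - (ln (INR g) / 2 - (INR g - 1) / 2 * ln (2 * PI * INR lam)) =
  (stirling (g * lam) - ln (2 * PI) / 2) - INR g * (stirling lam - ln (2 * PI) / 2)).
{ unfold p, stirling, Rdiv at 1. rewrite ln_mult, ln_Rinv, ln_mult, !ln_pow by (try apply Rinv_0_lt_compat; lra).
  rewrite mult_INR. rewrite (ln_mult (2 * PI) (INR lam)), (ln_mult (INR g) (INR lam)) by lra. field. }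
rewrite e. rewrite mult_INR in s1.
set (u := stirling (g * lam) - ln (2 * PI) / 2) in *.
set (v := stirling lam - ln (2 * PI) / 2) in *.
assert (hi : 0 < / INR lam) by (apply Rinv_0_lt_compat; lra).
assert (h1 : / (4 * (INR g * INR lam)) <= INR g / INR lam).
{ replace (/ (4 * (INR g * INR lam))) with (/ (4 * INR g) * / INR lam) by (field; lra).
  apply Rmult_le_compat_r; [lra|]. apply Rle_trans with 1; [|lra].
  rewrite <- Rinv_1; apply Rinv_le_contravar; lra. }
assert (h2 : INR g * v <= INR g / INR lam).
{ apply Rmult_le_compat_l; [lra|]. apply Rle_trans with (/ (4 * INR lam)); [lra|].
  apply Rinv_le_contravar; lra. }
assert (0 <= INR g * v) by (apply Rmult_le_pos; lra).
apply Rabs_le; lra.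
Qed.

(** Since 26 = 2 * 13, exp(L/2) is the 13th power of exp(L/26) >= L/26, one power more than
    needed. *)
Lemma pow12_exp_bound (L : R) : 0 < L -> L ^ 12 * exp (- L / 2) <= 26 ^ 13 / L.
Proof.
intros hL.
assert (h : (L / 26) ^ 13 <= exp (L / 2)).
{ replace (exp (L / 2)) with (exp (L / 26) ^ 13)
    by (rewrite exp_pow; f_equal; simpl (INR 13); field).
  apply pow_incr; split; [lra|]. pose proof (exp_ineq1 (L / 26)); lra. }
replace (- L / 2) with (- (L / 2)) by field. rewrite exp_Ropp.
apply (Rmult_le_reg_r (exp (L / 2) * L)); [apply Rmult_lt_0_compat; [apply exp_pos|lra]|].
pose proof (exp_pos (L / 2)).
replace (L ^ 12 * / exp (L / 2) * (exp (L / 2) * L)) with (26 ^ 13 * (L / 26) ^ 13) by (field; lra).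
replace (26 ^ 13 / L * (exp (L / 2) * L)) with (26 ^ 13 * exp (L / 2)) by (field; lra).
apply Rmult_le_compat_l; [apply pow_le; lra|exact h].
Qed.

(** For L = ln N and E = N^(-1/2) these are, in order: the two smallness conditions on d = L^2 E,
    the near error e, the Stirling error, and the far error relative to p^n. *)
Lemma parameters_small (G delta : R) : 1 <= G -> 0 < delta ->
  exists L0, 1 <= L0 /\ forall L, L0 <= L ->
    let E := exp (- L / 2) in
    64 * (L ^ 2 * (L ^ 2 * E)) <= 1 /\ 4 * (G * (L ^ 2 * E)) <= 1 /\
    exp (8192 * (L ^ 12 * E)) - 1 <= delta /\ L ^ 2 * (G ^ 2 * E ^ 2) <= delta /\
    4 * exp (- (L ^ 4 / (2592 * G ^ 3)) + G * L ^ 2 * (L + 4)) <= delta.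
Proof.
intros hG hd.
assert (hl : 0 < ln (1 + delta)) by (rewrite <- ln_1; apply ln_increasing; lra).
set (y0 := Rmin (Rmin (1 / 64) (/ (4 * G))) (Rmin (ln (1 + delta) / 8192) (delta / G ^ 2))).
assert (hG2 : 0 < G ^ 2) by (apply pow_lt; lra).
assert (hy0 : 0 < y0).
{ unfold y0; repeat apply Rmin_pos; try lra.
  - apply Rinv_0_lt_compat; lra.
  - apply Rdiv_lt_0_compat; lra. }
assert (b1 : y0 <= 1 / 64) by (unfold y0; eapply Rle_trans; [apply Rmin_l|apply Rmin_l]).
assert (b2 : y0 <= / (4 * G)) by (unfold y0; eapply Rle_trans; [apply Rmin_l|apply Rmin_r]).
assert (b3 : y0 <= ln (1 + delta) / 8192) by (unfold y0; eapply Rle_trans; [apply Rmin_r|apply Rmin_l]).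
assert (b4 : y0 <= delta / G ^ 2) by (unfold y0; eapply Rle_trans; [apply Rmin_r|apply Rmin_r]).
clearbody y0.
(* For L >= A, L^4 / (2592 G^3) is at least (5 G + 1) L^3, while G L^2 (L + 4) <= 5 G L^3; the
   surplus L^3 >= L gives decay. *)
set (A := 2592 * G ^ 3 * (5 * G + 1)).
assert (hG3 : 1 <= G ^ 3) by (apply pow_R1_Rle; lra).
assert (hA : 1 <= A) by (unfold A; nra).
exists (1 + A + 26 ^ 13 / y0 + 4 / delta).
assert (t1 : 0 < 26 ^ 13 / y0) by (apply Rdiv_lt_0_compat; [apply pow_lt|]; lra).
assert (t2 : 0 < 4 / delta) by (apply Rdiv_lt_0_compat; lra).
split; [lra|]. intros L hL E.
assert (L1 : 1 <= L) by lra.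
assert (E0 : 0 < E) by apply exp_pos.
assert (E1 : E <= 1) by (unfold E; rewrite <- exp_0; apply exp_mono; lra).
assert (hy : L ^ 12 * E <= y0).
{ eapply Rle_trans; [apply pow12_exp_bound; lra|].
  apply (Rmult_le_reg_r L); [lra|].
  replace (26 ^ 13 / L * L) with (26 ^ 13) by (field; lra).
  apply (Rmult_le_reg_r (/ y0)); [apply Rinv_0_lt_compat; lra|].
  replace (y0 * L * / y0) with L by (field; lra). unfold Rdiv in t1, hL |- *. lra. }
assert (pw : forall j, (j <= 12)%nat -> L ^ j * E <= y0).
{ intros j hj. apply Rle_trans with (L ^ 12 * E); [|exact hy].
  apply Rmult_le_compat_r; [lra|]. apply Rle_pow; [lra|lia]. }
pose proof (pw 2%nat ltac:(lia)) as p2. pose proof (pw 4%nat ltac:(lia)) as p4.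
assert (L2 : 0 < L ^ 2) by (apply pow_lt; lra).
repeat split.
- replace (L ^ 2 * (L ^ 2 * E)) with (L ^ 4 * E) by ring. lra.
- apply Rle_trans with (4 * (G * / (4 * G))); [|right; field; lra].
  apply Rmult_le_compat_l; [lra|]. apply Rmult_le_compat_l; lra.
- apply Rle_trans with (exp (ln (1 + delta)) - 1); [|rewrite exp_ln; lra].
  apply Rplus_le_compat_r, exp_mono; lra.
- apply Rle_trans with (G ^ 2 * (delta / G ^ 2)); [|right; field; lra].
  replace (L ^ 2 * (G ^ 2 * E ^ 2)) with (G ^ 2 * (L ^ 2 * E * E)) by ring.
  apply Rmult_le_compat_l; [lra|].
  assert (0 <= L ^ 2 * E) by (apply Rmult_le_pos; lra). nra.
- assert (hexp : - (L ^ 4 / (2592 * G ^ 3)) + G * L ^ 2 * (L + 4) <= - L).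
  { assert (L ^ 3 * (5 * G + 1) <= L ^ 4 / (2592 * G ^ 3)).
    { apply (Rmult_le_reg_r (2592 * G ^ 3)); [lra|].
      replace (L ^ 4 / (2592 * G ^ 3) * (2592 * G ^ 3)) with (L ^ 3 * L) by (field; lra).
      replace (L ^ 3 * (5 * G + 1) * (2592 * G ^ 3)) with (L ^ 3 * A) by (unfold A; ring).
      apply Rmult_le_compat_l; [apply pow_le|]; lra. }
    assert (a1 : L ^ 2 <= L ^ 3) by (apply Rle_pow; [lra|lia]).
    assert (a2 : L ^ 1 <= L ^ 3) by (apply Rle_pow; [lra|lia]). simpl (L ^ 1) in a2.
    assert (G * L ^ 2 <= G * L ^ 3) by (apply Rmult_le_compat_l; lra).
    replace (G * L ^ 2 * (L + 4)) with (G * L ^ 3 + 4 * (G * L ^ 2)) by ring. lra. }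
  apply exp_mono in hexp. rewrite exp_Ropp in hexp.
  assert (/ exp L <= / L).
  { apply Rinv_le_contravar; [lra|]. pose proof (exp_ineq1 L); lra. }
  assert (/ L <= / (4 / delta)) by (apply Rinv_le_contravar; lra).
  replace (/ (4 / delta)) with (delta / 4) in * by (field; lra). lra.
Qed.

Lemma perturbed_ratio (Y s delta : R) : 0 < delta <= 1 / 2 ->
  Rabs (Y - 1) <= 5 * delta -> Rabs s <= delta -> Rabs (Y * exp s - 1) <= 12 * delta.
Proof.
intros hd hY hs.
apply Rabs_le_inv in hs.
assert (l : 1 - delta <= exp s) by (pose proof (exp_ineq1_le s); lra).
assert (u : exp s <= 1 + 2 * delta).
{ assert (h : 1 - delta <= exp (- s)) by (pose proof (exp_ineq1_le (- s)); lra).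
  assert (e : exp s * exp (- s) = 1) by (rewrite <- exp_plus, <- exp_0; f_equal; ring).
  pose proof (exp_pos s). nra. }
replace (Y * exp s - 1) with ((Y - 1) * exp s + (exp s - 1)) by ring.
eapply Rle_trans; [apply Rabs_triang|].
rewrite Rabs_mult, (Rabs_right (exp s)) by (left; apply exp_pos).
assert (Rabs (exp s - 1) <= 2 * delta) by (apply Rabs_le; lra).
assert (Rabs (Y - 1) * exp s <= 5 * delta * 2).
{ apply Rmult_le_compat; [apply Rabs_pos|left; apply exp_pos|exact hY|lra]. }
lra.
Qed.

(** * The limit along the sequence *)

Theorem theorem1p2 (g : nat) (hg : (2 <= g)%nat) (k lam : nat -> nat)
  (hk : forall n, (3 <= k n)%nat)
  (hlam_pos : forall n, (1 <= lam n)%nat)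
  (hlam_inf : forall M : nat, exists N : nat, forall n, (N <= n)%nat -> (M <= lam n)%nat)
  (hlam_even : Nat.Even g -> forall n, Nat.Even (lam n))
  (heps : exists eps0 : R, 0 < eps0 /\
     forall n, INR (k n) < (1/6 - eps0) * ln (INR (lam n * g)) / ln (INR g)) :
  Un_cv
    (fun n =>
       INR (num_diff_matrices g (k n) (lam n)) /
       (Rpower (INR g)
          (INR (k n * lam n * g) + (3 * INR (k n) - 4) * (INR (k n) - 1) / 4)
        / sqrt ((2 * PI * INR (lam n)) ^ (choose (k n) 2 * (g - 1)))))
    1.
Proof.
intros eta heta.
assert (G2 : 2 <= INR g) by (apply (le_INR 2); lia).
(* The final error is 12 [delta], so 13 makes it strictly smaller than [eta]. *)
set (delta := Rmin (1 / 2) (eta / 13)).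
assert (hd : 0 < delta) by (apply Rmin_pos; lra).
assert (hd2 : delta <= 1 / 2) by apply Rmin_l.
assert (hd3 : delta <= eta / 13) by apply Rmin_r.
destruct (parameters_small (INR g) delta) as [L0 [L01 hL0]]; [lra|exact hd|].
destruct (INR_archimed 1 (exp L0)) as [M hM]; [lra|].
destruct (hlam_inf M) as [n0 hn0].
exists n0; intros i hi. specialize (hn0 i hi).
destruct heps as [eps [heps hki]]. specialize (hki i).
specialize (hk i). specialize (hlam_pos i).
assert (hev : Nat.Even g -> Nat.Even (lam i)) by (intros hh; apply hlam_even; exact hh).
set (kk := k i) in *. set (la := lam i) in *. clearbody kk la. clear hlam_inf hlam_even hi.
set (G := INR g) in *. set (L := ln (INR (la * g))) in *.
assert (k3 : 3 <= INR kk) by (replace 3 with (INR 3) by (simpl; lra); apply le_INR; lia).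
assert (l1 : 1 <= INR la) by (apply (le_INR 1); lia).
assert (hN : INR (g * la) = exp L).
{ unfold L; rewrite exp_ln; [f_equal; lia|]. rewrite mult_INR; fold G; nra. }
assert (hNG : exp L = G * INR la) by (rewrite <- hN; apply mult_INR).
assert (hL : L0 <= L).
{ rewrite <- (ln_exp L0). unfold L. apply Rnot_lt_le; intros hlt.
  apply ln_lt_inv in hlt; [|rewrite mult_INR; fold G; nra|apply exp_pos].
  assert (INR M <= INR la) by (apply le_INR; exact hn0).
  rewrite mult_INR in hlt; fold G in hlt; nra. }
(* As ln g >= 1/2, the hypothesis on k yields k <= L, whence n <= L^2 below. *)
assert (hkL : INR kk <= L).
{ assert (hlg : 1 / 2 <= ln G).
  { apply Rle_trans with (ln 2); [pose proof ln_lt_2; lra|].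
    destruct G2 as [G2|G2]; [left; apply ln_increasing; lra|rewrite <- G2; lra]. }
  assert (hx : INR kk * ln G < (1 / 6 - eps) * L).
  { apply (Rmult_lt_compat_r (ln G)) in hki; [|lra].
    replace ((1 / 6 - eps) * L / ln G * ln G) with ((1 / 6 - eps) * L) in hki by (field; lra).
    exact hki. }
  nra. }
set (n := choose kk 2).
assert (hn2 : 2 * INR n = INR kk * (INR kk - 1)).
{ pose proof (f_equal INR (choose2 kk)) as e. rewrite !mult_INR, minus_INR in e by lia.
  exact e. }
assert (n0' : 0 <= INR n) by apply pos_INR.
assert (hnL : INR n <= L ^ 2) by nra.
destruct (hL0 L hL) as [c1 [c2 [c3 [c4 c5]]]]. clear hL0.
set (E := exp (- L / 2)) in *.
assert (E0 : 0 < E) by apply exp_pos.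
assert (EN : E ^ 2 * exp L = 1).
{ unfold E; rewrite exp_pow, <- exp_plus, <- exp_0; f_equal; simpl (INR 2); field. }
set (d := L ^ 2 * E) in *.
assert (L2 : 0 < L ^ 2) by (apply pow_lt; lra).
assert (d0 : 0 < d) by (apply Rmult_lt_0_compat; lra).
assert (d1 : d <= 1) by nra.
assert (nd : INR n * d <= L ^ 2 * d) by (apply Rmult_le_compat_r; lra).
assert (nd0 : 0 <= INR n * d) by (apply Rmult_le_pos; lra).
set (e := exp (8192 * (L ^ 12 * E)) - 1) in *.
assert (x0 : 0 <= L ^ 12 * E) by (apply Rmult_le_pos; [apply pow_le|]; lra).
assert (e0 : 0 <= e).
{ unfold e; pose proof (exp_ineq1_le (8192 * (L ^ 12 * E))); lra. }
(* By 1 + x <= exp x the power is at most exp(2 N (16 L^4 E)^3); 2 * 16^3 = 8192, and E^2 N = 1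
   leaves L^12 E. *)
assert (he : (1 + 2 * (16 * (INR n * d)) ^ 3) ^ (g * la) <= 1 + e).
{ replace (1 + e) with (exp (8192 * (L ^ 12 * E))) by (unfold e; ring).
  apply Rle_trans with (exp (2 * (16 * (L ^ 2 * d)) ^ 3) ^ (g * la)).
  - assert (h3 : (16 * (INR n * d)) ^ 3 <= (16 * (L ^ 2 * d)) ^ 3) by (apply pow_incr; lra).
    assert (0 <= (16 * (INR n * d)) ^ 3) by (apply pow_le; lra).
    apply pow_incr; split; [lra|].
    pose proof (exp_ineq1_le (2 * (16 * (L ^ 2 * d)) ^ 3)); lra.
  - rewrite exp_pow, hN. right; f_equal. unfold d.
    replace (exp L * (2 * (16 * (L ^ 2 * (L ^ 2 * E))) ^ 3)) with
      (8192 * (L ^ 12 * E) * (E ^ 2 * exp L)) by ring.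
    rewrite EN; ring. }
pose proof (@num_diff_matrices_estimate g kk la d e) as est. cbv zeta in est.

specialize (est ltac:(lia) ltac:(lia) hev d0 d1 ltac:(fold n; lra) ltac:(fold G; lra) he e0 ltac:(lra)).
fold n G in est.
destruct (ln_equidistribution g la) as [p0 hp]; [lia|lia|].
change (Nat.mul g la) with (g * la)%nat in est. fold G in p0, hp.
set (p := INR (fact (g * la)) / (INR (fact la) ^ g * G ^ (g * la))) in *.
set (h := G ^ n * G / G ^ kk) in *.
set (rho := 1 - (d / G) ^ 2 / (2592 * G)) in *.
set (num := INR (num_diff_matrices g kk la)) in *.
set (r := ln p - (ln G / 2 - (G - 1) / 2 * ln (2 * PI * INR la))) in *.
pose proof PI_RGT_0 as hpi. pose proof PI_4 as hpi4.
assert (h0 : 0 < h).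
{ apply Rdiv_lt_0_compat; [apply Rmult_lt_0_compat; [apply pow_lt|]|apply pow_lt]; lra. }
assert (pn0 : 0 < p ^ n) by (apply pow_lt, p0).
assert (hgl : 0 < G / INR la) by (apply Rdiv_lt_0_compat; lra).
assert (hr : Rabs (INR n * r) <= delta).
{ rewrite Rabs_mult, (Rabs_right (INR n)) by lra.
  apply Rle_trans with (L ^ 2 * (G / INR la)).
  - apply Rmult_le_compat; try lra; apply Rabs_pos.
  - replace (G / INR la) with (G ^ 2 * E ^ 2); [lra|].
    apply (Rmult_eq_reg_r (exp L)); [|pose proof (exp_pos L); lra].
    rewrite Rmult_assoc, EN, hNG. field; lra. }
assert (hpn : exp (- (G * L ^ 2 * (L + 4))) <= p ^ n).
{ rewrite <- (exp_ln p) by exact p0. rewrite exp_pow. apply exp_mono.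
  assert (hln : ln (2 * PI * INR la) <= L + 3).
  { rewrite <- (ln_exp (L + 3)). apply Rnot_lt_le; intros hlt.
    apply ln_lt_inv in hlt; [|apply exp_pos|apply Rmult_lt_0_compat; lra].
    rewrite exp_plus, hNG in hlt. pose proof (exp_ineq1_le 3).
    assert (8 <= G * exp 3) by nra.
    assert (2 * PI * INR la <= G * exp 3 * INR la) by (apply Rmult_le_compat_r; lra). lra. }
  assert (hlp : - (G * (L + 4)) <= ln p).
  { apply Rabs_le_inv in hp. fold r in hp.
    assert (hgl2 : G / INR la <= G).
    { apply (Rmult_le_reg_r (INR la)); [lra|]. replace (G / INR la * INR la) with G by (field; lra). nra. }
    assert (lg0 : 0 <= ln G) by (rewrite <- ln_1; left; apply ln_increasing; lra).
    assert (ln p = r + ln G / 2 - (G - 1) / 2 * ln (2 * PI * INR la)) by (unfold r; ring).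
    assert ((G - 1) / 2 * ln (2 * PI * INR la) <= (G - 1) / 2 * (L + 3)) by (apply Rmult_le_compat_l; lra).
    nra. }
  assert (INR n * (- (G * (L + 4))) <= INR n * ln p) by (apply Rmult_le_compat_l; lra).
  assert (INR n * (G * (L + 4)) <= L ^ 2 * (G * (L + 4))) by (apply Rmult_le_compat_r; nra).
  lra. }
assert (hrho : rho ^ (g * la) <= exp (- (L ^ 4 / (2592 * G ^ 3)))).
{ set (q := (d / G) ^ 2 / (2592 * G)).
  assert (dg : 0 <= d / G <= 1).
  { split; [left; apply Rdiv_lt_0_compat; lra|].
    apply (Rmult_le_reg_r G); [lra|]. replace (d / G * G) with d by (field; lra). lra. }
  assert (q1 : q <= 1).
  { unfold q; apply (Rmult_le_reg_r (2592 * G)); [lra|].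
    replace ((d / G) ^ 2 / (2592 * G) * (2592 * G)) with ((d / G) ^ 2) by (field; lra). nra. }
  apply Rle_trans with (exp (- q) ^ (g * la)).
  - apply pow_incr; unfold rho; fold q. pose proof (exp_ineq1_le (- q)); lra.
  - rewrite exp_pow, hN. right; f_equal. unfold q, d.
    replace (exp L * - ((L ^ 2 * E / G) ^ 2 / (2592 * G))) with
      (- (L ^ 4 / (2592 * G ^ 3) * (E ^ 2 * exp L))) by (field; lra).
    rewrite EN; ring. }
set (A := num / G ^ (kk * (g * la))) in *.
(* One [delta] comes from the far frequencies, through [hpn] and [hrho], and four from the near
   error 4 e. *)
assert (hY : Rabs (A / (h * p ^ n) - 1) <= 5 * delta).
{ assert (hh : 0 < h * p ^ n) by (apply Rmult_lt_0_compat; lra).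
  replace (A / (h * p ^ n) - 1) with ((A - h * p ^ n) * / (h * p ^ n)) by (field; lra).
  rewrite Rabs_mult, (Rabs_right (/ (h * p ^ n))) by (left; apply Rinv_0_lt_compat; exact hh).
  apply (Rmult_le_reg_r (h * p ^ n)); [exact hh|].
  rewrite Rmult_assoc, Rinv_l, Rmult_1_r by lra.
  apply (Rle_trans _ _ _ est).
  replace (5 * delta * (h * p ^ n)) with (h * (5 * delta * p ^ n)) by ring.
  apply Rmult_le_compat_l; [lra|].
  assert (4 * rho ^ (g * la) <= delta * p ^ n).
  { apply Rle_trans with (delta * exp (- (G * L ^ 2 * (L + 4)))); [|apply Rmult_le_compat_l; lra].
    apply Rle_trans with (4 * exp (- (L ^ 4 / (2592 * G ^ 3)))); [lra|].
    rewrite exp_plus in c5.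
    apply (Rmult_le_compat_r (exp (- (G * L ^ 2 * (L + 4))))) in c5; [|left; apply exp_pos].
    rewrite !Rmult_assoc, <- exp_plus in c5.
    replace (G * (L ^ 2 * (L + 4)) + - (G * (L ^ 2 * (L + 4)))) with 0 in c5 by ring.
    rewrite exp_0 in c5. rewrite !Rmult_assoc. lra. }
  assert (4 * e * p ^ n <= 4 * delta * p ^ n) by (apply Rmult_le_compat_r; lra).
  lra. }
pose proof (perturbed_ratio _ _ _ (conj hd hd2) hY hr) as fin.
unfold Rdist.
(* An exact identity: n r is the whole Stirling discrepancy, and the powers of g agree because (n +
   1 - k) + n/2 = (3k - 4)(k - 1)/4. *)
match goal with |- Rabs (?X - 1) < eta => assert (hX : X = A / (h * p ^ n) * exp (INR n * r)) end.
{ set (y := ln (2 * PI * INR la)).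
  assert (hs : (2 * PI * INR la) ^ (n * (g - 1)) = exp (INR n * (G - 1) * y)).
  { rewrite <- (exp_ln (2 * PI * INR la)) by (apply Rmult_lt_0_compat; lra).
    rewrite exp_pow, mult_INR, minus_INR by lia. reflexivity. }
  rewrite hs, sqrt_exp. unfold Rpower.
  assert (GX : forall j, G ^ j = exp (INR j * ln G)).
  { intros j. rewrite <- (exp_ln G) at 1 by lra. apply exp_pow. }
  assert (hE : h = exp ((INR n + 1 - INR kk) * ln G)).
  { unfold h. replace (G ^ n * G) with (G ^ S n) by (simpl; ring).
    unfold Rdiv. rewrite !GX, <- exp_Ropp, <- exp_plus, S_INR. f_equal; ring. }
  rewrite hE. unfold A. rewrite GX.
  assert (ep : p ^ n = exp (INR n * (r + ln G / 2 - (G - 1) / 2 * y))).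
  { rewrite <- (exp_ln p) at 1 by exact p0. rewrite exp_pow. f_equal. unfold r, y. ring. }
  rewrite ep. unfold Rdiv. rewrite <- !exp_Ropp, <- !exp_plus, <- !exp_Ropp.
  rewrite !Rmult_assoc, <- !exp_plus. f_equal. f_equal.
  assert (INR n = INR kk * (INR kk - 1) / 2) as -> by lra.
  rewrite !mult_INR. fold G.  field. }
rewrite hX. lra.
Qed.
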